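(* The closed orbits of $AN$ in $AdS_l$ are $[AN]$ and $[ANk_\theta]$, where $k_\theta=e^{\pi q_0}\in K$ is the element such that $\theta=\operatorname{Ad}(k_\theta)$. The closed orbits of $A\bar N$ in $AdS_l$ are $[A\bar N]$ and $[A\bar Nk_\theta]$. All the other orbits of $AN$ and of $A\bar N$ are open.
   Context: Let $l\ge 3$. Here $SO(p,q)$ denotes the identity component of the special orthogonal group of signature $(p,q)$. Let $G=SO(2,l-1)$ act on $\mathbb R^{2,l-1}$ (two positive and $l-1$ negative directions), let $H=SO(1,l-1)\subset G$ be the stabilizer of a vector of square norm $+1$, with Lie algebras $\mathfrak g,\mathfrak h$, and let $AdS_l=G/H$ with projection $\pi:G\to G/H$, $[g]=\pi(g)$; for $M\subset G$ put $[M]=\pi(M)$. Let $\sigma$ be the involutive automorphism of $\mathfrak g$ whose $+1$-eigenspace is $\mathfrak h$, and let $\mathfrak q$ be its $-1$-eigenspace. Let $\theta$ be a Cartan involution of $\mathfrak g$ commuting with $\sigma$, with $+1$-eigenspace $\mathfrak k$ and $-1$-eigenspace $\mathfrak p$. Let $\mathfrak a\subset\mathfrak p$ be a maximal abelian subalgebra with a basis $J_1\in\mathfrak h$, $J_2\in\mathfrak q$, normalized so that, writing $\mathfrak g_{(\alpha,\beta)}=\{X\in\mathfrak g:[J_1,X]=\alpha X,\ [J_2,X]=\beta X\}$, the restricted roots are $(\pm1,\pm1)$ and, if $l\ge4$, $(\pm1,0),(0,\pm1)$. Iwasawa data: $\mathfrak n=\mathfrak g_{(1,1)}\oplus\mathfrak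 g_{(1,-1)}\oplus\mathfrak g_{(1,0)}\oplus\mathfrak g_{(0,1)}$, $\bar{\mathfrak n}=\theta\mathfrak n$; $A,N,\bar N$ are the connected subgroups of $G$ with Lie algebras $\mathfrak a,\mathfrak n,\bar{\mathfrak n}$, and $K=SO(2)\times SO(l-1)$ is the maximal compact subgroup with Lie algebra $\mathfrak k$. The groups $AN$ and $A\bar N$ act on $AdS_l$ by $r\cdot[g]=[rg]$. Choose $X_{++}\in\mathfrak g_{(1,1)}$ with $[\theta X_{++},X_{++}]=4(J_1+J_2)$ and put $q_0=\tfrac14(X_{++}-\sigma X_{++}+\theta X_{++}-\sigma\theta X_{++})\in\mathfrak k\cap\mathfrak q$; the $SO(2)$ factor of $K$ is $\{e^{xq_0}\}$. *)

(* Defs.v *)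
From HB Require Import structures.
From mathcomp Require Import all_boot all_order all_algebra all_field.
From mathcomp Require Import generic_quotient.
From mathcomp Require Import all_classical all_reals all_analysis.

Set Implicit Arguments.
Unset Strict Implicit.
Unset Printing Implicit Defensive.

Import Order.TTheory GRing.Theory Num.Theory.
Import numFieldNormedType.Exports.

Local Open Scope classical_set_scope.
Local Open Scope ring_scope.
Local Open Scope quotient_scope.

Section MatrixGroups.
Variables (R : realType) (n : nat).
Local Notation M := 'M[R]_n.+1.

Definition expm (X : M) : M :=
  limn (series (fun k : nat => (k`!%:R : R)^-1 *: X ^+ k)).

Definition is_subgroup (S : set M) : Prop :=
  [/\ S 1, forall x, S x -> x \is a GRing.unit,
      forall x y, S x -> S y -> S (x * y) & forall x, S x -> S x^-1].

Definition lie_algebra_of (S : set M) (s : {vspace M}) : Prop :=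
  forall X, X \in s <-> forall t : R, S (expm (t *: X)).

(* The connected Lie subgroup with Lie algebra s, as the abstract subgroup
   generated by exp s. *)
Definition connected_subgroup (s : {vspace M}) : set M :=
  [set g | forall S : set M, is_subgroup S ->
     (forall X, X \in s -> S (expm X)) -> S g].

Definition maximal_compact_subgroup (G K : set M) : Prop :=
  [/\ is_subgroup K, K `<=` G, compact K &
      forall K', is_subgroup K' -> K' `<=` G -> compact K' ->
        K `<=` K' -> K' = K].

Definition ad (X : M) : 'End(M) := (amull X - amulr X)%VF.

(* The trace of ad X o ad Y on g, computed in the basis vbasis g; X and Y are
   meant to be in the subalgebra g. *)
Definition killing (g : {vspace M}) (X Y : M) : R :=
  \sum_(i < \dim g) coord (vbasis g) i (ad X (ad Y (vbasis g)`_i)).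

(* Automorphisms of g are carried by endomorphisms of the whole matrix space,
   of which only the restriction to g is ever used. *)
Definition involutive_automorphism (g : {vspace M}) (f : 'End(M)) : Prop :=
  [/\ (f @: g)%VS = g,
      forall X Y, X \in g -> Y \in g -> f (ad X Y) = ad (f X) (f Y) &
      forall X, X \in g -> f (f X) = X].

Definition cartan_involution (g : {vspace M}) (f : 'End(M)) : Prop :=
  involutive_automorphism g f /\
  forall X, X \in g -> X != 0 -> 0 < - killing g X (f X).

Definition eigensubspace (g : {vspace M}) (f : 'End(M)) (c : R) : {vspace M} :=
  (g :&: passmx.leigenspace f c)%VS.

Definition abelian_subspace (a : {vspace M}) : Prop :=
  forall X Y, X \in a -> Y \in a -> ad X Y = 0.

Definition maximal_abelian (p a : {vspace M}) : Prop :=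
  [/\ (a <= p)%VS, abelian_subspace a &
      forall b : {vspace M}, (b <= p)%VS -> abelian_subspace b ->
        (a <= b)%VS -> b = a].

Definition root_space (g : {vspace M}) (J1 J2 : M) (al be : R) : {vspace M} :=
  (g :&: passmx.leigenspace (ad J1) al :&: passmx.leigenspace (ad J2) be)%VS.

Definition is_restricted_root (g : {vspace M}) (J1 J2 : M) (al be : R) : Prop :=
  (al, be) <> (0, 0) /\ root_space g J1 J2 al be <> 0%VS.

Definition positive_part (g : {vspace M}) (J1 J2 : M) : {vspace M} :=
  (root_space g J1 J2 1 1 + root_space g J1 J2 1 (-1)
   + root_space g J1 J2 1 0 + root_space g J1 J2 0 1)%VS.

Definition prod_set (A B : set M) : set M := [set x * y | x in A & y in B].

Definition rtranslate (A : set M) (k : M) : set M := [set x * k | x in A].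

End MatrixGroups.

Section AntiDeSitter.
Variables (R : realType) (l : nat).
Local Notation M := 'M[R]_l.+1.

(* R^{2,l-1} is 'cV[R]_l.+1 with the form diag(1, 1, -1, ..., -1). *)
Definition form_mx : M := diag_mx (\row_i (if (i < 2)%N then 1 else -1)).

Definition sqnorm (v : 'cV[R]_l.+1) : R := (v^T *m form_mx *m v) 0 0.

Definition SO_full : set M := [set g | g^T * form_mx * g = form_mx /\ \det g = 1].

(* What is written SO(2, l-1): the identity component. *)
Definition SO0 : set M := connected_component SO_full 1.

(* SO(1, l-1) when sqnorm v = 1 *)
Definition stab (v : 'cV[R]_l.+1) : set M := [set g | SO0 g /\ g *m v = v].

Lemma SO_full_subgroup : is_subgroup SO_full.
Proof.
have U x : SO_full x -> x \is a GRing.unit.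
  by move=> [_ d]; rewrite unitmxE d unitr1.
split => //.
- by split; rewrite ?det1 // trmx1 mul1r mulr1.
- move=> x y [ex dx] [ey dy]; split; last by rewrite det_mulmx dx dy mulr1.
  rewrite (_ : (x * y)^T = y^T * x^T); last exact: trmx_mul.
  by rewrite -[RHS]ey -[in RHS]ex !mulrA.
- move=> x Sx; have ux := U _ Sx; case: Sx => ex dx.
  split; last by rewrite -[x^-1]/(invmx x) det_inv dx invr1.
  rewrite -[in LHS]ex !mulrA.
  have -> : (x^-1)^T * x^T = 1.
    by rewrite -[LHS](trmx_mul x (x^-1)) -[x *m _]/(x * x^-1) divrr // trmx1.
  by rewrite mul1r -mulrA divrr // mulr1.
Qed.

Lemma mulmx_continuous (x : M) : continuous (fun y : M => x * y).
Proof.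
move=> y B [P nP sPB].
have H : \forall z \near y, forall i j, P i j ((x * z) i j).
  apply: (@filter_forall M _ (fun i z => forall j, P i j ((x * z) i j)) (nbhs y) (nbhs_filter y)) => i.
  apply: (@filter_forall M _ (fun j z => P i j ((x * z) i j)) (nbhs y) (nbhs_filter y)) => j.
  have sum_cont (r : seq 'I_l.+1) :
      continuous (fun z : M => \sum_(k <- r) x i k * z k j : R).
    elim: r => [|k r IHr] t.
      rewrite (_ : (fun z : M => _) = fun=> 0); first exact: cst_continuous.
      by apply/funext => z; rewrite big_nil.
    rewrite (_ : (fun z : M => _) =
      fun z : M => x i k * z k j + \sum_(k <- r) x i k * z k j).
      apply: (@continuousD R R^o _ (fun z : M => x i k * z k j)); last exact: IHr.
      apply: (@continuousM R _ (fun=> x i k) (fun z : M => z k j)).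
        exact: cst_continuous.
      exact: coord_continuous.
    by apply/funext => z; rewrite big_cons.
  have E z : (x * z) i j = \sum_k x i k * z k j by rewrite mxE.
  have Pxy : nbhs (\sum_k x i k * y k j) (P i j) by rewrite -E; exact: nP.
  apply: (@filterS M (nbhs y) (nbhs_filter y) _ _ _ (sum_cont _ y (P i j) Pxy)) => z.
  by rewrite /preimage /= E.
by apply: (@filterS M (nbhs y) (nbhs_filter y) _ _ _ H) => z Hz; exact: sPB.
Qed.

Lemma SO0_sub : SO0 `<=` SO_full.
Proof. exact: connected_component_sub. Qed.

Lemma SO0_subgroup : is_subgroup SO0.
Proof.
have [S1 SU SM SV] := SO_full_subgroup.
have translate x y : SO_full x -> SO0 y ->
    connected_component SO_full x (x * y).
  move=> Sx [C [C1 CS Cc] Cy]; exists ((fun z => x * z) @` C).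
    split.
    - by exists 1 => //; rewrite mulr1.
    - by move=> _ [z Cz <-]; apply: SM => //; exact: CS.
    - apply: connected_continuous_connected => //.
      exact: continuous_subspaceT (@mulmx_continuous x).
  by exists y.
split.
- exact: connected_component_refl.
- by move=> x /SO0_sub; exact: SU.
- move=> x y Gx Gy; apply: (connected_component_trans Gx).
  exact: translate (SO0_sub Gx) Gy.
- move=> x Gx; have Sx := SO0_sub Gx.
  apply: connected_component_sym.
  by rewrite -[1](mulVr (SU _ Sx)); exact: translate (SV _ Sx) Gx.
Qed.

Lemma stab_subgroup v : is_subgroup (stab v).
Proof.
have [S1 SU SM SV] := SO0_subgroup.
split.
- by split => //; rewrite mul1mx.
- by move=> x [/SU].
- move=> x y [Gx xv] [Gy yv]; split; first exact: SM.
  by rewrite -[x * y]/(x *m y) -mulmxA yv.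
- move=> x [Gx xv]; split; first exact: SV.
  by rewrite -{1}xv mulmxA -[_ *m x]/(x^-1 * x) mulVr ?mul1mx //; exact: SU.
Qed.

Definition coset_rel (v : 'cV[R]_l.+1) : rel (set_type SO0) :=
  fun x y => `[< stab v ((val x)^-1 * val y) >].

Lemma coset_rel_equiv v : equiv_class_of (coset_rel v).
Proof.
have [S1 SU SM SV] := stab_subgroup v.
have [_ GU _ _] := SO0_subgroup.
have U (x : set_type SO0) : val x \is a GRing.unit by apply/GU/set_mem/(valP x).
split.
- by move=> x; apply/asboolP; rewrite mulVr.
- have sym x y : coset_rel v x y -> coset_rel v y x.
    move=> /asboolP/SV; rewrite invrM ?unitrV // invrK => ?; exact/asboolP.
  by move=> x y; apply/idP/idP; exact: sym.
- move=> y x z /asboolP xy /asboolP yz; apply/asboolP.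
  by have := SM _ _ xy yz; rewrite mulrA mulrK.
Qed.

Canonical coset_equiv v := EquivRelPack (coset_rel_equiv v).

Definition AdS (v : 'cV[R]_l.+1) : Type :=
  quotient_topology {eq_quot (coset_equiv v)}.

(* The projection to AdS of a set of matrices contained in SO0: only its
   intersection with SO0 counts. *)
Definition AdS_proj (v : 'cV[R]_l.+1) (S : set M) : set (AdS v) :=
  [set \pi_(AdS v) x | x in [set x : set_type SO0 | S (val x)]].

Lemma SO0_mul_subproof (x y : set_type SO0) : val x * val y \in SO0.
Proof.
have [_ _ SM _] := SO0_subgroup.
by apply/mem_set/SM; [exact/set_mem/(valP x) | exact/set_mem/(valP y)].
Qed.

Definition SO0_mul (x y : set_type SO0) : set_type SO0 :=
  Sub (val x * val y) (SO0_mul_subproof x y).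

(* The action is r . [g] = [r g], for r in a subgroup S of SO0. *)
Definition AdS_orbit (v : 'cV[R]_l.+1) (S : set M) (p : AdS v) : set (AdS v) :=
  [set \pi_(AdS v) (SO0_mul r g) |
    r in [set r : set_type SO0 | S (val r)] &
    g in [set g : set_type SO0 | \pi_(AdS v) g = p]].

Definition AdS_orbits (v : 'cV[R]_l.+1) (S : set M) : set (set (AdS v)) :=
  [set AdS_orbit S p | p in [set: AdS v]].

Definition listed_root (al be : R) : Prop :=
  (al \in [:: 1; -1] /\ be \in [:: 1; -1]) \/
  ((4 <= l)%N /\
   ((al \in [:: 1; -1] /\ be = 0) \/ (al = 0 /\ be \in [:: 1; -1]))).

End AntiDeSitter.

Arguments form_mx : clear implicits.
Arguments SO_full : clear implicits.
Arguments SO0 : clear implicits.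
Arguments AdS_proj {R l} v S.
Arguments AdS_orbit {R l} v S p.
Arguments AdS_orbits {R l} v S.

(* Main.v *)
Require Import Defs.
From HB Require Import structures.
From mathcomp Require Import all_boot all_order all_algebra all_field.
From mathcomp Require Import ring lra.
From mathcomp Require Import all_classical all_reals all_analysis.

Set Implicit Arguments.
Unset Strict Implicit.
Unset Printing Implicit Defensive.

Import Order.TTheory GRing.Theory Num.Theory.
Import numFieldNormedType.Exports.

(* Identify [g] with the skew matrices of the form and [AdS] with the hyperboloid of
   vectors of norm 1 through [g |-> g v]. The element [J2] of [q] is [u /\ v], and the
   normalization of [X++] forces [X++ = e0 /\ (v + u)], [theta X++ = e1 /\ (v - u)] and
   [J1 = (e0 /\ e1) / 2], where [e0], [e1] are null with [<e0, e1> = 2]. Hence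
   [q0 = w /\ v] with [w = (e0 + e1) / 2] of norm 1, so that [k_theta] negates the
   positive plane spanned by [v] and [w] and fixes its orthogonal; conjugation by it is
   a Cartan involution commuting with [theta], and two commuting Cartan involutions
   coincide.

   With [e = e0] and [f = v + u], the group [A N] preserves the isotropic flag spanned
   by [e], then [e] and [f], and scales both steps by positive factors. On the
   hyperboloid the sign of [<e, x>], and the sign of [<f, x>] where [<e, x> = 0], are
   therefore invariant; they separate the orbits because the exponentials of
   [e /\ z] and [f /\ z] are explicit unipotent isometries. The signature (2, l-1)
   excludes [<e, x> = <f, x> = 0]. The point [v] satisfies [<e, v> = 0], and [k_theta]
   maps it to [- v]. For [theta N] apply [k_theta] to the flag. *)

Local Open Scope classical_set_scope.
Local Open Scope ring_scope.

(** * The form of signature (2, l-1) *)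

Lemma addmxE (R : nmodType) m n (A B : 'M[R]_(m, n)) i j :
  (A + B) i j = A i j + B i j.
Proof. by rewrite mxE. Qed.

Lemma oppmxE (R : zmodType) m n (A : 'M[R]_(m, n)) i j :
  (- A) i j = - A i j.
Proof. by rewrite mxE. Qed.

Lemma scalemxE (R : pzRingType) m n c (A : 'M[R]_(m, n)) i j :
  (c *: A) i j = c * A i j.
Proof. by rewrite mxE. Qed.

Lemma zeromxE (R : nmodType) m n i j : (0 : 'M[R]_(m, n)) i j = 0.
Proof. by rewrite mxE. Qed.

Definition linmxE := (addmxE, oppmxE, scalemxE, zeromxE).

Section LorentzForm.
Variables (R : realType) (l : nat).
Local Notation M := 'M[R]_l.+1.
Local Notation V := 'cV[R]_l.+1.
Local Notation eta := (form_mx R l).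

Definition bform (x y : V) : R := (x^T *m eta *m y) 0 0.
Local Notation "<[ x , y ]>" := (bform x y) (at level 0, x, y at level 99).

Definition sgn (i : 'I_l.+1) : R := if (i < 2)%N then 1 else -1.

Lemma bformE x y : <[x, y]> = \sum_i sgn i * (x i 0 * y i 0).
Proof.
rewrite /bform mul_mx_diag mxE; apply: eq_bigr => i _.
by rewrite !mxE mulrAC mulrC mulrA.
Qed.

Lemma bformC x y : <[x, y]> = <[y, x]>.
Proof. by rewrite !bformE; apply: eq_bigr => i _; rewrite [x i 0 * _]mulrC. Qed.

Lemma bformDr x y z : <[x, y + z]> = <[x, y]> + <[x, z]>.
Proof. by rewrite /bform mulmxDr mxE. Qed.

Lemma bformZr c x y : <[x, c *: y]> = c * <[x, y]>.
Proof. by rewrite /bform -scalemxAr mxE. Qed.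

Lemma bformNr x y : <[x, - y]> = - <[x, y]>.
Proof. by rewrite -scaleN1r bformZr mulN1r. Qed.

Lemma bformBr x y z : <[x, y - z]> = <[x, y]> - <[x, z]>.
Proof. by rewrite bformDr bformNr. Qed.

Lemma bform0r x : <[x, 0]> = 0.
Proof. by rewrite /bform mulmx0 mxE. Qed.

Lemma bformDl x y z : <[y + z, x]> = <[y, x]> + <[z, x]>.
Proof. by rewrite !(bformC _ x) bformDr. Qed.

Lemma bformZl c x y : <[c *: y, x]> = c * <[y, x]>.
Proof. by rewrite !(bformC _ x) bformZr. Qed.

Lemma bformNl x y : <[- y, x]> = - <[y, x]>.
Proof. by rewrite !(bformC _ x) bformNr. Qed.

Lemma bformBl x y z : <[y - z, x]> = <[y, x]> - <[z, x]>.
Proof. by rewrite !(bformC _ x) bformBr. Qed.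

Lemma bform0l x : <[0, x]> = 0.
Proof. by rewrite bformC bform0r. Qed.

Definition bformD := (bformDl, bformDr, bformBl, bformBr, bformNl, bformNr,
  bformZl, bformZr, bform0l, bform0r).

Lemma bform_delta i x : <[delta_mx i 0, x]> = sgn i * x i 0.
Proof.
rewrite bformE (bigD1 i) //= big1 ?addr0 => [|j ji].
  by rewrite mxE !eqxx mul1r.
by rewrite mxE (negPf ji) mul0r mulr0.
Qed.

Lemma sgn_sqr i : sgn i * sgn i = 1.
Proof. by rewrite /sgn; case: ifP; rewrite ?mulr1 // mulrNN mulr1. Qed.

Lemma bform_nondegenerate x : (forall y, <[y, x]> = 0) -> x = 0.
Proof.
move=> H; apply/colP => i; rewrite mxE.
have := H (delta_mx i 0); rewrite bform_delta => /(congr1 (fun t => sgn i * t)).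
by rewrite mulrA sgn_sqr mul1r mulr0.
Qed.

Lemma eq_mulmx_col (X Y : M) : (forall x : V, X *m x = Y *m x) -> X = Y.
Proof.
move=> H; apply/matrixP => i j.
have /colP/(_ i) := H (delta_mx j 0); rewrite -!colE.
by rewrite !mxE.
Qed.

Definition skew (X : M) := forall x y, <[X *m x, y]> = - <[x, X *m y]>.

Lemma bform_trmx (X : M) x y :
  <[X *m x, y]> = (x^T *m (X^T *m eta) *m y) 0 0.
Proof. by rewrite /bform trmx_mul !mulmxA. Qed.

Lemma mx_bilinear_eq (X Y : M) :
  (forall x y : V, (x^T *m X *m y) 0 0 = (x^T *m Y *m y) 0 0) -> X = Y.
Proof.
move=> H; apply/matrixP => i j.
have := H (delta_mx i 0) (delta_mx j 0).
by rewrite !trmx_delta -!rowE -!colE !mxE.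
Qed.

Lemma skewP (X : M) : skew X <-> X^T *m eta + eta *m X = 0.
Proof.
split=> [sX|E x y].
  apply: mx_bilinear_eq => x y.
  rewrite mulmxDr mulmxDl addmxE -bform_trmx sX.
  by rewrite mulmx0 mul0mx zeromxE /bform !mulmxA addNr.
rewrite bform_trmx -[X^T *m eta](addrK (eta *m X)) E sub0r mulmxN mulNmx mxE.
by rewrite /bform !mulmxA.
Qed.

Lemma skew_trmx (X : M) : skew X -> X^T *m eta = - (eta *m X).
Proof. by move=> /skewP /eqP; rewrite addr_eq0 => /eqP. Qed.

Lemma eta_sqr : eta *m eta = 1%:M.
Proof.
rewrite mulmx_diag; apply/matrixP => i j; rewrite !mxE; congr (_ *+ _).
exact: sgn_sqr.
Qed.

Lemma eta_tr : eta^T = eta. Proof. exact: tr_diag_mx. Qed.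

Lemma skew_eta (X : M) : skew X -> eta *m X^T *m eta = - X.
Proof. by move=> sX; rewrite -mulmxA skew_trmx // mulmxN mulmxA eta_sqr mul1mx. Qed.

Lemma skew0 X x : skew X -> <[x, X *m x]> = 0.
Proof. by move=> sX; have := sX x x; rewrite bformC => H; lra. Qed.

(** A skew matrix is conjugate by [eta] to the opposite of its transpose, and the trace ignores both
    conjugation and transposition. *)
Lemma skew_tr0 (X : M) : skew X -> \tr X = 0.
Proof.
move=> sX; have : \tr (eta *m X^T *m eta) = - \tr X.
  by rewrite skew_eta // linearN.
rewrite -mulmxA mxtrace_mulC -mulmxA eta_sqr mulmx1 mxtrace_tr => H; lra.
Qed.

(** The skew matrix that corresponds to the bivector of [a] and [b] under the isomorphism of the
    exterior square with so(2, l-1). It is locked so that computations go through its action on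
    columns, [wedgeE]. *)
Definition wedge (a b : V) : M :=
  locked (a *m (b^T *m eta) - b *m (a^T *m eta)).

Lemma wedgeE a b x : wedge a b *m x = <[b, x]> *: a - <[a, x]> *: b.
Proof.
have H (u w : V) : u *m (w^T *m eta) *m x = <[w, x]> *: u.
  by rewrite -mulmxA [_ *m x]mx11_scalar mul_mx_scalar.
by rewrite /wedge -lock mulmxBl !H.
Qed.

Lemma skew_wedge a b : skew (wedge a b).
Proof.
by move=> x y; rewrite !wedgeE !bformD !(bformC x); ring.
Qed.

(** Pairing with wedges under the trace form reads off the matrix coefficients of [X]; this turns
    Killing orthogonality into statements about vectors. *)
Lemma mxtrace_mul_wedge (X : M) a b :
  \tr (X *m wedge a b) = <[b, X *m a]> - <[a, X *m b]>.
Proof.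
have H (u w : V) : \tr (X *m (u *m (w^T *m eta))) = <[w, X *m u]>.
  by rewrite mulmxA mxtrace_mulC mulmxA trace_mx11 /bform mulmxA.
by rewrite /wedge -lock mulmxBr linearB /= !H.
Qed.

Lemma adE (X Y : M) : ad X Y = X *m Y - Y *m X.
Proof. by rewrite /ad !lfunE /= !lfunE /= lfunE. Qed.

Lemma ad_wedge X a b : skew X ->
  ad X (wedge a b) = wedge (X *m a) b + wedge a (X *m b).
Proof.
move=> sX; rewrite adE; apply: eq_mulmx_col => x.
rewrite mulmxBl mulmxDl -(mulmxA X) -(mulmxA (wedge a b)) !wedgeE !sX mulmxBr -!scalemxAr.
by apply/colP => i; rewrite !linmxE; ring.
Qed.

End LorentzForm.

(** * The exponential of a matrix *)

Section MatrixExponential.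
Variables (R : realType) (l : nat).
Local Notation M := 'M[R]_l.+1.
Local Notation V := 'cV[R]_l.+1.

Lemma cvg_matrix (T : topologicalType) m n (F : set_system T) (FF : Filter F)
    (f : T -> 'M[R]_(m, n)) (L : 'M[R]_(m, n)) :
  (forall i j, (fun x => f x i j) @ F --> L i j) -> f @ F --> L.
Proof.
move=> H A [P nP sPA].
have {}H : \forall x \near F, forall i j, P i j (f x i j).
  by apply: filter_forall => i; apply: filter_forall => j; exact/H/nP.
by apply: filterS H => x Hx; exact: sPA.
Qed.

(** This sum dominates every row sum of absolute values, so the entries of the powers of [X] are
    bounded by its powers and the scalar exponential series dominates the matrix one. *)
Definition mxabs_sum (X : M) : R := \sum_i \sum_j `|X i j|.

Lemma mxabs_sum_ge0 (X : M) : 0 <= mxabs_sum X.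
Proof. by do 2 (apply: sumr_ge0 => ? _). Qed.

Lemma normr_mxX (X : M) k i j : `|(X ^+ k) i j| <= mxabs_sum X ^+ k.
Proof.
elim: k i j => [|k IH] i j.
  by rewrite !expr0 mxE; case: (i == j); rewrite ?normr1 ?normr0.
rewrite !exprS [(X * _) i j]mxE; apply: le_trans (ler_norm_sum _ _ _) _.
apply: (@le_trans _ _ (\sum_m `|X i m| * mxabs_sum X ^+ k)).
  by apply: ler_sum => m _; rewrite normrM ler_wpM2l.
rewrite -mulr_suml ler_wpM2r ?exprn_ge0 ?mxabs_sum_ge0 //.
rewrite /mxabs_sum [leRHS](bigD1 i) //= lerDl.
by do 2 (apply: sumr_ge0 => ? _).
Qed.

Definition expm_coeff (X : M) i j : R^nat :=
  fun k => (k`!%:R)^-1 * (X ^+ k) i j.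

Lemma normr_expm_coeff (X : M) i j k :
  `|expm_coeff X i j k| <= exp_coeff (mxabs_sum X) k.
Proof.
rewrite /expm_coeff /exp_coeff /= normrM mulrC normfV normr_nat.
by rewrite ler_wpM2r ?invr_ge0 // normr_mxX.
Qed.

Lemma is_cvg_expm_coeff (X : M) i j : cvgn (series (expm_coeff X i j)).
Proof.
apply: normed_cvg; apply: series_le_cvg (is_cvg_series_exp_coeff (mxabs_sum X)).
- by move=> n; exact: normr_ge0.
- by move=> n; rewrite exp_coeff_ge0 // mxabs_sum_ge0.
- exact: normr_expm_coeff.
Qed.

(** The limit that defines [expm] carries information only once convergence is known. Entrywise
    domination provides it, and the Hausdorff property identifies the limit. *)
Lemma cvg_expm (X : M) i j : series (expm_coeff X i j) @ \oo --> expm X i j.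
Proof.
pose L : M := \matrix_(i, j) limn (series (expm_coeff X i j)).
suff -> : expm X = L by rewrite mxE; exact: is_cvg_expm_coeff.
apply: cvg_lim; first exact: norm_hausdorff.
apply: cvg_matrix => a b; rewrite mxE.
rewrite (_ : (fun n => _) = series (expm_coeff X a b)).
  exact: is_cvg_expm_coeff.
apply/funext => n; rewrite /series /= summxE; apply: eq_bigr => k _.
by rewrite mxE.
Qed.

(** Reduces the action of an exponential on one vector to the vectors [X ^+ k *m x], which are
    explicit for eigenvectors and for vectors killed by a power of [X]. *)
Lemma cvg_expm_mul (X : M) (x : V) i :
  series (fun k => (k`!%:R)^-1 * (X ^+ k *m x) i 0) @ \oo --> (expm X *m x) i 0.
Proof.
rewrite (_ : series _ = fun n => \sum_j series (expm_coeff X i j) n * x j 0).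
  rewrite mxE; apply: cvg_big => [|j _].
    exact: add_continuous.
  by apply: cvgMr_tmp; exact: cvg_expm.
apply/funext => n; rewrite /series /=.
under [RHS]eq_bigr => j _ do rewrite mulr_suml.
rewrite exchange_big /=; apply: eq_bigr => k _.
by rewrite mxE mulr_sumr; apply: eq_bigr => j _; rewrite mulrA.
Qed.

Lemma expm_eigen (X : M) (x : V) c : X *m x = c *: x -> expm X *m x = expR c *: x.
Proof.
move=> Xx; apply/colP => i.
have XkE k : X ^+ k *m x = c ^+ k *: x.
  elim: k => [|k IH]; first by rewrite !expr0 mul1mx scale1r.
  rewrite exprS -[X * _]/(X *m _) -mulmxA IH -scalemxAr Xx scalerA.
  by rewrite -exprSr.
apply: (cvg_unique _ (@cvg_expm_mul X x i)) => //.
rewrite linmxE (_ : series _ = fun n => series (exp_coeff c) n * x i 0).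
  by apply: cvgMr_tmp; exact: is_cvg_series_exp_coeff.
apply/funext => n; rewrite /series /= mulr_suml; apply: eq_bigr => k _.
by rewrite XkE linmxE mulrCA mulrA.
Qed.

Lemma expm_nilpotent (X : M) (x : V) : X *m (X *m (X *m x)) = 0 ->
  expm X *m x = x + X *m x + 2^-1 *: (X *m (X *m x)).
Proof.
move=> X3; apply/colP => i.
have XS k (y : V) : X ^+ k.+1 *m y = X ^+ k *m (X *m y).
  by rewrite exprSr -[_ * X]/(_ *m X) -mulmxA.
apply: (cvg_unique _ (@cvg_expm_mul X x i)) => //.
apply: cvg_near_cst; exists 3%N => // n /= n3.
rewrite /series /= -(subnKC n3) big_mkord !big_ord_recl big1 => [|k _].
  rewrite /= /bump /= !XS expr0 !mul1mx !linmxE !fact0 invr1 addr0.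
  by rewrite !mul1r addrA.
by rewrite /= /bump /= !XS X3 mulmx0 mxE mulr0.
Qed.

(** Since the cube of [X] is [- X], odd powers are signed copies of [X] and positive even powers
    signed copies of [X * X], which sorts the series into sine and cosine. *)
Lemma expm_rotation (X : M) (t : R) : X * X * X = - X ->
  expm (t *: X) = 1 + sin t *: X + (1 - cos t) *: (X * X).
Proof.
move=> X3; apply/matrixP => i j.
apply: (cvg_unique _ (@cvg_expm (t *: X) i j)) => //.
have XE k : (X ^+ k.*2.+1 = (-1) ^+ k *: X) /\
    (X ^+ k.*2.+2 = (-1) ^+ k *: (X * X)).
  have E m : X ^+ m.+2.+1 = - X ^+ m.+1.
    have E3 : X ^+ 3 = - X by rewrite exprS expr2 mulrA.
    by rewrite -addn3 exprD E3 mulrN -exprSr.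
  elim: k => [|k [IH1 IH2]]; first by rewrite !expr0 !scale1r.
  by rewrite doubleS !E IH1 IH2 exprS -!scaleNr !mulN1r.
pose c0 : R^nat := fun k => (k == 0)%:R.
have cvg0 : series c0 @ \oo --> (1 : R).
  apply: cvg_near_cst; exists 1%N => // n /= n1.
  by rewrite /series /= -(prednK n1) big_nat_recl // big1 ?addr0.
(* The power of index 0 breaks the alternating pattern: it is 1 where the cosine series contributes
   [- (X * X)]. The sequence [c0] adds the correction [1 + X * X] at that index. *)
rewrite (_ : series _ = fun n => series c0 n * (1 + X * X) i j
    + series (sin_coeff t) n * X i j - series (cos_coeff t) n * (X * X) i j).
  have -> : (1 + sin t *: X + (1 - cos t) *: (X * X)) i j =
      1 * (1 + X * X) i j + sin t * X i j - cos t * (X * X) i j.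
    by rewrite !linmxE; ring.
  apply: cvgB; first apply: cvgD.
  - exact: cvgMr_tmp.
  - by apply: cvgMr_tmp; rewrite unlock; exact: is_cvg_series_sin_coeff.
  - by apply: cvgMr_tmp; rewrite unlock; exact: is_cvg_series_cos_coeff.
apply/funext => n; rewrite /series /= !mulr_suml -big_split -sumrB /=.
apply: eq_bigr => k _; rewrite /expm_coeff exprZn !linmxE.
case: k => [|k]; last rewrite /c0 mul0r add0r.
  rewrite /sin_coeff /cos_coeff /= /c0 !expr0 fact0 invr1 eqxx -exprnP expr0.
  by rewrite (_ : true%:R = 1 :> R) // !mul0r !mul1r addr0 addrK.
have [m [-> | ->]] : exists m, k = m.*2 \/ k = m.*2.+1.
  exists k./2; rewrite -{1 3}(odd_double_half k).
  by case: (odd k); [right | left].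
- rewrite (XE m).1 cos_coeff_odd -sin_coeff'E /sin_coeff' -exprnP !linmxE.
  by ring.
- rewrite (XE m).2 -doubleS sin_coeff_even -cos_coeff'E /cos_coeff' -exprnP.
  by rewrite !linmxE exprS; ring.
Qed.

(** For [t] in the unit ball every term of index at least 2 is at most [t ^+ 2] times the
    corresponding term of a scalar exponential series. The derivative at 0 follows without
    differentiating a series term by term. *)
Lemma expm_derivative (X : M) t i j : `|t| <= 1 ->
  `|expm (t *: X) i j - ((1 : M) i j + t * X i j)| <= t ^+ 2 * expR (mxabs_sum X).
Proof.
move=> t1; set L := _ + t * X i j.
have cvgL := @cvg_expm (t *: X) i j.
suff H : \forall n \near \oo,
    `|series (expm_coeff (t *: X) i j) n - L| <= t ^+ 2 * expR (mxabs_sum X).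
  have cN : `|series (expm_coeff (t *: X) i j) n - L| @[n --> \oo] -->
      `|expm (t *: X) i j - L|.
    by apply: cvg_norm; apply: cvgB => //; exact: cvg_cst.
  rewrite -(cvg_lim _ cN) //; apply: limr_le => //; apply/cvg_ex; eexists; exact: cN.
near=> n.
have n2 : (2 <= n)%N by near: n; exists 2%N.
have -> : series (expm_coeff (t *: X) i j) n - L =
    \sum_(2 <= k < n) expm_coeff (t *: X) i j k.
  rewrite /series /= big_ltn ?(ltnW n2) // big_ltn // addrA.
  rewrite {1 2}/expm_coeff expr0 expr1 fact0 (_ : 1`! = 1)%N // invr1.
  by rewrite !mul1r scalemxE [LHS]addrAC subrr add0r.
apply: le_trans (ler_norm_sum _ _ _) _.
apply: (@le_trans _ _ (\sum_(2 <= k < n) t ^+ 2 * exp_coeff (mxabs_sum X) k)).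
  rewrite big_nat [leRHS]big_nat; apply: ler_sum => k /andP[k2 _].
  rewrite /expm_coeff exprZn linmxE mulrCA normrM.
  apply: ler_pM => //; last exact: normr_expm_coeff.
  rewrite -(subnKC k2) exprD normrM [X in X * _]ger0_norm ?sqr_ge0 //.
  by rewrite ler_piMr ?sqr_ge0 // normrX exprn_ile1.
rewrite -mulr_sumr ler_wpM2l ?sqr_ge0 //.
apply: (@le_trans _ _ (series (exp_coeff (mxabs_sum X)) n)).
  rewrite /series /= [leRHS]big_ltn ?(ltnW n2) // [X in _ + X]big_ltn // addrA.
  by rewrite lerDr addr_ge0 // exp_coeff_ge0 ?mxabs_sum_ge0.
apply: nondecreasing_cvgn_le; last exact: is_cvg_series_exp_coeff.
apply: nondecreasing_series => k _ _.
by rewrite exp_coeff_ge0 ?mxabs_sum_ge0.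
Unshelve. all: by end_near. Qed.

End MatrixExponential.

(** * The Lie algebras of SO(2, l-1) and of a stabilizer *)

Section LieAlgebra.
Variables (R : realType) (l : nat).
Local Notation M := 'M[R]_l.+1.
Local Notation V := 'cV[R]_l.+1.
Local Notation eta := (form_mx R l).
Local Notation "<[ x , y ]>" := (bform x y) (at level 0, x, y at level 99).

Lemma is_derive_quadratic_bound (f : R -> R) (b a C : R) : 0 <= C ->
  (forall t, `|t| <= 1 -> `|f t - (b + t * a)| <= t ^+ 2 * C) ->
  is_derive (0 : R) 1 f a.
Proof.
move=> C0 H.
have f0 : f 0 = b.
  have := H 0; rewrite normr0 ler01 => /(_ isT).
  by rewrite expr0n mul0r mul0r addr0 normr_le0 subr_eq0 => /eqP.
have cv : h^-1 *: ((f \o shift 0) (h *: 1) - f 0) @[h --> (0 : R)^'] --> a.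
  apply/cvgrPdist_le => e e0; near=> h.
  have h0 : h != 0 by near: h; exact: nbhs_dnbhs_neq.
  (* The denominator is [C + 1] rather than [C] because [C] may vanish. *)
  have h1 : `|h| <= Num.min 1 (e / (C + 1)).
    near: h; apply: dnbhs0_le; rewrite lt_min ltr01 /= divr_gt0 //.
    exact: ltr_wpDl.
  move: h1; rewrite le_min => /andP[h1 he].
  rewrite /= /shift /= addr0 f0.
  have -> : a - h^-1 *: (f (h *: 1) - b) = - (h^-1 * (f h - (b + h * a))).
    rewrite /GRing.scale /= mulr1; by field.
  rewrite normrN normrM normfV mulrC ler_pdivrMr ?normr_gt0 //.
  apply: le_trans (H _ h1) _.
  rewrite -real_normK ?num_real // expr2 -mulrA mulrC ler_pM2r ?normr_gt0 //.
  move: he; rewrite ler_pdivlMr; last exact: ltr_wpDl.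
  by apply: le_trans; rewrite ler_wpM2l // lerDl.
by split; [apply/cvg_ex; exists a | exact: cvg_lim cv].
Unshelve. all: by end_near. Qed.

Lemma is_derive_expm (X : M) i j :
  is_derive (0 : R) 1 (fun t => expm (t *: X) i j) (X i j).
Proof.
apply: (@is_derive_quadratic_bound _ ((1 : M) i j) _ (expR (mxabs_sum X))).
  exact: expR_ge0.
by move=> t t1; exact: expm_derivative.
Qed.

Lemma expm_at0 (X : M) i j : expm ((0 : R) *: X) i j = (1 : M) i j.
Proof.
have := @expm_derivative R l X 0 i j; rewrite normr0 ler01 => /(_ isT).
by rewrite expr0n mul0r mul0r addr0 normr_le0 subr_eq0 => /eqP.
Qed.

Lemma SO_full_bform (g : M) x y : SO_full R l g -> <[g *m x, g *m y]> = <[x, y]>.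
Proof.
move=> [gg _]; rewrite bform_trmx /bform.
rewrite -[in RHS]gg -[g^T * eta * g]/(g^T *m eta *m g).
by rewrite !mulmxA.
Qed.

Lemma det_eta_neq0 : \det eta != 0.
Proof.
apply/eqP => d0; have /eqP := congr1 determinant (eta_sqr R l).
by rewrite det_mulmx d0 mul0r det1 eq_sym oner_eq0.
Qed.

Lemma bform_isometry (g : M) :
  (forall x y, <[g *m x, g *m y]> = <[x, y]>) -> g^T *m eta *m g = eta.
Proof.
move=> H; apply: mx_bilinear_eq => x y.
by have := H x y; rewrite bform_trmx /bform !mulmxA.
Qed.

(** Differentiate at 0 the constant function that pairs the images of two basis vectors under
    [expm (t *: X)]; this gives the skewness equation entry by entry. *)
Lemma skew_lie (X : M) : (forall t : R, SO_full R l (expm (t *: X))) -> skew X.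
Proof.
move=> H; apply/skewP/matrixP => a b.
pose f i : R -> R := fun t => sgn R i * (expm (t *: X) i a * expm (t *: X) i b).
pose df i : R := sgn R i * ((1 : M) i a * X i b + (1 : M) i b * X i a).
have Df i : is_derive (0 : R) 1 (f i) (df i).
  apply: is_derive_eq; first apply: is_deriveM; first apply: is_deriveM.
  - exact: is_derive_expm.
  - exact: is_derive_expm.
  by rewrite /df !expm_at0 /GRing.scale /=; ring.
have := is_derive_sum Df.
have -> : \sum_i f i = cst <[delta_mx a 0, delta_mx b 0]>.
  apply/funext => t; rewrite fct_sumE -(SO_full_bform _ _ (H t)) bformE.
  by apply: eq_bigr => i _; rewrite -!colE !mxE.
case=> _; rewrite derive_cst => D0.
rewrite addmxE mul_mx_diag mul_diag_mx !mxE [RHS]D0 /df.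
rewrite -/(sgn R a) -/(sgn R b).
under eq_bigr => i _ do rewrite mulrDr.
rewrite big_split /= addrC; congr (_ + _).
  rewrite (bigD1 a) //= big1 ?addr0 => [|i ia].
    by rewrite mxE eqxx mul1r.
  by rewrite mxE (negPf ia) mul0r mulr0.
rewrite (bigD1 b) //= big1 ?addr0 => [|i ib].
  by rewrite mxE eqxx mul1r mulrC.
by rewrite mxE (negPf ib) mul0r mulr0.
Qed.

Lemma fixed_lie (X : M) (v : V) :
  (forall t : R, expm (t *: X) *m v = v) -> X *m v = 0.
Proof.
move=> H; apply/colP => i.
have Df j : is_derive (0 : R) 1 (fun t => expm (t *: X) i j * v j 0 : R)
    (X i j * v j 0).
  apply: is_derive_eq; first apply: is_deriveM; first exact: is_derive_expm.
  by rewrite /GRing.scale /=; ring.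
have := is_derive_sum Df.
have -> : \sum_j (fun t => expm (t *: X) i j * v j 0) = cst (v i 0).
  by apply/funext => t; rewrite fct_sumE -[in RHS](H t) mxE.
by case=> _; rewrite derive_cst !mxE.
Qed.

Lemma continuous_quadratic_mx (A B C : M) :
  continuous (fun t : R => A + t *: B + t ^+ 2 *: C).
Proof.
move=> t; apply: cvg_matrix => i j.
rewrite (_ : (fun x => _) = fun x => A i j + x * B i j + x ^+ 2 * C i j).
  rewrite !linmxE; apply: cvgD; first apply: cvgD; first exact: cvg_cst.
    by apply: cvgMr_tmp; exact: cvg_id.
  by apply: cvgMr_tmp; exact: exprn_continuous.
by apply/funext => x; rewrite !linmxE.
Qed.

Lemma expm_nilpotent_mx (X : M) : X * X * X = 0 ->
  expm X = 1 + X + 2^-1 *: (X * X).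
Proof.
move=> X3; apply: eq_mulmx_col => x.
have E : X *m (X *m (X *m x)) = 0 by rewrite !mulmxA [_ *m X *m X]X3 mul0mx.
by rewrite expm_nilpotent // !mulmxDl mul1mx -scalemxAl -mulmxA.
Qed.

(** The exponential of [t *: X] is the quadratic polynomial [p t], so [p] on the unit interval is a
    path of isometries from 1 to [expm X]. Its determinant is 1 because [p t] is the square of the
    isometry [p (t / 2)], whose determinant squares to 1. *)
Lemma SO0_expm_nilpotent (X : M) : skew X -> X * X * X = 0 -> SO0 R l (expm X).
Proof.
move=> sX X3.
pose p (t : R) : M := 1 + t *: X + t ^+ 2 *: (2^-1 *: (X * X)).
have pE t (x : V) : p t *m x = x + t *: (X *m x) + (t ^+ 2 / 2) *: (X *m (X *m x)).
  by rewrite /p !mulmxDl mul1mx -!scalemxAl -mulmxA scalerA.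
have X3x (x : V) : X *m (X *m (X *m x)) = 0.
  by rewrite !mulmxA [_ *m X *m X]X3 mul0mx.
have isom t x y : <[p t *m x, p t *m y]> = <[x, y]>.
  rewrite !pE !bformD !sX !X3x mulmx0 !bform0r.
  by field.
have pp t : p t = p (t / 2) * p (t / 2).
  apply: eq_mulmx_col => x; rewrite -[_ * _]/(_ *m _) -mulmxA !pE.
  rewrite !(mulmxDr X) -!scalemxAr !X3x ?mulmx0 !scaler0.
  by apply/colP => i; rewrite !linmxE; by field.
have pSO t : SO_full R l (p t).
  have H := fun t => bform_isometry (isom t).
  split; first exact: H.
  have /(congr1 determinant) := H (t / 2).
  rewrite !det_mulmx det_tr mulrAC => /(congr1 (fun z => z / \det eta)).
  rewrite mulfK ?det_eta_neq0 // divff ?det_eta_neq0 // => <-.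
  by rewrite pp -[_ * _]/(_ *m _) det_mulmx.
exists (p @` `[0, 1]).
  split.
  - exists 0; last by rewrite /p scale0r expr0n /= scale0r !addr0.
    by rewrite /= in_itv /= lexx ler01.
  - by move=> _ [t _ <-].
  - apply: connected_continuous_connected; first exact: segment_connected.
    apply: continuous_subspaceT; exact: continuous_quadratic_mx.
exists 1; first by rewrite /= in_itv /= lexx ler01.
by rewrite expm_nilpotent_mx // /p scale1r expr1n scale1r.
Qed.

Lemma null_wedge_cube (e z : V) : <[e, e]> = 0 -> <[e, z]> = 0 ->
  wedge e z * wedge e z * wedge e z = 0.
Proof.
move=> ee ez; apply: eq_mulmx_col => x.
rewrite mul0mx -[_ * _ * _]/(_ *m _ *m _) -!mulmxA !wedgeE !bformD.
by rewrite ee ez (bformC z e) ez; apply/colP => i; rewrite !linmxE; ring.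
Qed.

Lemma wedgeDl (a b c : V) : wedge (a + b) c = wedge a c + wedge b c.
Proof.
apply: eq_mulmx_col => x; rewrite mulmxDl !wedgeE bformDl.
by apply/colP => i; rewrite !linmxE; ring.
Qed.

Lemma wedgeZl k (a c : V) : wedge (k *: a) c = k *: wedge a c.
Proof.
apply: eq_mulmx_col => x; rewrite -scalemxAl !wedgeE bformZl.
by apply/colP => i; rewrite !linmxE; ring.
Qed.

Lemma wedgeC (a b : V) : wedge a b = - wedge b a.
Proof.
apply: eq_mulmx_col => x; rewrite mulNmx !wedgeE.
by apply/colP => i; rewrite !linmxE; ring.
Qed.

Lemma wedgeZr k (a c : V) : wedge a (k *: c) = k *: wedge a c.
Proof. by rewrite wedgeC wedgeZl -scalerN -wedgeC. Qed.

Section WithLieAlgebra.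
Variable g : {vspace M}.
Hypotheses (l_ge3 : (3 <= l)%N) (g_lie : lie_algebra_of (SO0 R l) g).

Lemma null_wedge_mem (e z : V) : <[e, e]> = 0 -> <[e, z]> = 0 -> wedge e z \in g.
Proof.
move=> ee ez; apply/g_lie => t; rewrite -wedgeZl.
apply: SO0_expm_nilpotent; first exact: skew_wedge.
by apply: null_wedge_cube; rewrite !bformD ?ee ?ez ?mulr0.
Qed.

(** For [l] at least 3 each sign occurs at two indices at least: 0 and 1 are positive, 2 and 3
    negative. One of the two differs from [k]. *)
Lemma ex_opposite_sgn (i k : 'I_l.+1) : exists j, sgn R j = - sgn R i /\ j != k.
Proof.
have H m : (m < 4)%N -> (m < l.+1)%N by move=> ?; apply: (@leq_trans 4).
pose o m (H4 : (m < 4)%N) : 'I_l.+1 := Ordinal (H m H4).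
case: (ltnP i 2) => i2; rewrite /sgn ?i2 ?(ltnNge i 2) ?i2 /=.
- have [->|k2] := eqVneq k (@o 2 isT); first by exists (@o 3 isT).
  by exists (@o 2 isT); rewrite eq_sym.
- have [->|k2] := eqVneq k (@o 0 isT); first by exists (@o 1 isT); rewrite opprK.
  by exists (@o 0 isT); rewrite opprK eq_sym.
Qed.

Lemma bform_delta2 (i j : 'I_l.+1) :
  <[delta_mx i 0, delta_mx j 0]> = sgn R i * (i == j)%:R.
Proof. by rewrite bform_delta mxE andbT. Qed.

(* With [sgn j = - sgn i], the vectors [e_i + e_j] and [e_i - e_j] are null; their
   wedges with [e_k] add up to twice [wedge e_i e_k]. *)
Lemma delta_wedge_mem (i k : 'I_l.+1) : wedge (delta_mx i 0 : V) (delta_mx k 0) \in g.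
Proof.
have [->|ik] := eqVneq i k.
  suff -> : wedge (delta_mx k 0 : V) (delta_mx k 0) = 0 by rewrite mem0v.
  by apply: eq_mulmx_col => x; rewrite wedgeE mul0mx subrr.
have [j [sj jk]] := ex_opposite_sgn i k.
have ij : i != j.
  apply/eqP => ij; move: sj; rewrite -ij => /eqP.
  by rewrite -addr_eq0 -mulr2n mulrn_eq0 /= /sgn; case: ifP => _; rewrite ?oppr_eq0 oner_eq0.
set a : V := delta_mx i 0; set b : V := delta_mx j 0; set c : V := delta_mx k 0.
have mem s : s ^+ 2 = 1 -> wedge (a + s *: b) c \in g.
  move=> s2; apply: null_wedge_mem; rewrite /a /b /c !bformD !bform_delta2 ?eqxx.
    by rewrite (negPf ij) eq_sym (negPf ij) sj; ring: s2.
  by rewrite (negPf ik) (negPf jk) /= mulr0n !mulr0 addr0.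
have -> : wedge a c = 2^-1 *: (wedge (a + 1 *: b) c + wedge (a + (-1) *: b) c).
  rewrite !wedgeDl !wedgeZl; apply/matrixP => x y; rewrite !linmxE; by field.
by rewrite memvZ // memvD // mem // ?expr1n // sqrrN expr1n.
Qed.

(** Applied to [x], the wedges give two sums. The first is [X] applied to the expansion of [x] in
    the orthonormal basis; by skewness the second is the expansion of [X *m x]. Hence the factor one
    half. *)
Lemma skew_decomposition (X : M) : skew X ->
  X = 2^-1 *: \sum_i sgn R i *: wedge (X *m delta_mx i 0) (delta_mx i 0 : V).
Proof.
move=> sX; apply: eq_mulmx_col => x.
have expand (y : V) : \sum_i (sgn R i * <[delta_mx i 0, y]>) *: delta_mx i 0 = y.
  rewrite [RHS]matrix_sum_delta; apply: eq_bigr => i _.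
  by rewrite big_ord1 bform_delta mulrA sgn_sqr mul1r.
rewrite -scalemxAl mulmx_suml.
rewrite (eq_bigr (fun i => (sgn R i * <[delta_mx i 0, x]>) *: (X *m delta_mx i 0) +
   (sgn R i * <[delta_mx i 0, X *m x]>) *: delta_mx i 0)); last first.
  move=> i _; rewrite -scalemxAl wedgeE sX.
  by apply/colP => k; rewrite !linmxE; ring.
rewrite big_split /= expand.
under eq_bigr => i _ do rewrite scalemxAr.
rewrite -mulmx_sumr expand.
by apply/colP => i; rewrite !linmxE; by field.
Qed.

(** One inclusion is differentiation at 0. For the other, [g] is a linear space that contains the
    wedges of basis vectors, and these span the skew matrices; only nilpotent exponentials have to
    be placed in [SO0] by hand. *)
Lemma mem_lie_skew (X : M) : X \in g <-> skew X.
Proof.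
split=> [gX|sX].
  by apply: skew_lie => t; apply: SO0_sub; exact: (g_lie X).1 gX t.
rewrite (skew_decomposition sX) memvZ // memv_suml // => i _; rewrite memvZ //.
set y : V := X *m delta_mx i 0.
have -> : y = \sum_j y j 0 *: (delta_mx j 0 : V).
  by rewrite [LHS]matrix_sum_delta; apply: eq_bigr => j _; rewrite big_ord1.
have : forall r : seq 'I_l.+1, wedge (\sum_(j <- r) y j 0 *: (delta_mx j 0 : V))
   (delta_mx i 0) \in g.
  elim=> [|j r IH]; first by rewrite big_nil -(scale0r (0 : V)) wedgeZl scale0r mem0v.
  by rewrite big_cons wedgeDl wedgeZl memvD // memvZ // delta_wedge_mem.
exact.
Qed.

Lemma mem_stab_lie (v : V) (h : {vspace M}) : lie_algebra_of (stab v) h ->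
  forall X, X \in h <-> skew X /\ X *m v = 0.
Proof.
move=> h_lie X; split=> [/h_lie hX|[sX Xv]].
  split; last by apply: fixed_lie => t; case: (hX t).
  by apply: skew_lie => t; case: (hX t) => + _; exact: SO0_sub.
apply/h_lie => t; split; first by apply: (g_lie X).1; apply/mem_lie_skew.
rewrite (@expm_eigen _ _ _ _ 0) ?expR0 ?scale1r // scale0r.
by rewrite -scalemxAl Xv scaler0.
Qed.

End WithLieAlgebra.

End LieAlgebra.

(** * The Killing form *)

Section OperatorTrace.
Variables (R : realType) (l : nat).
Local Notation M := 'M[R]_l.+1.

(** The operator trace on the full matrix space, in the basis of matrix units. It replaces the
    unspecified basis of [g] in the Killing form by an explicit one. *)
Definition mx_lfun_trace (f : M -> M) : R :=
  \sum_i \sum_j f (delta_mx i j) i j.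

Lemma mx_lfun_trace_comp (f g : 'End(M)) :
  mx_lfun_trace (fun X => f (g X)) = mx_lfun_trace (fun X => g (f X)).
Proof.
have E (a b : 'End(M)) : mx_lfun_trace (fun X => a (b X)) =
    \sum_i \sum_j \sum_k \sum_m b (delta_mx i j) k m * a (delta_mx k m) i j.
  apply: eq_bigr => i _; apply: eq_bigr => j _.
  rewrite {1}[b _]matrix_sum_delta linear_sum summxE; apply: eq_bigr => k _.
  rewrite linear_sum summxE; apply: eq_bigr => m _.
  by rewrite linearZ mxE.
rewrite !E pair_bigA /=.
under eq_bigr => p _ do rewrite pair_bigA /=.
rewrite exchange_big /= [RHS]pair_bigA /=; apply: eq_bigr => p _.
rewrite [RHS]pair_bigA /=; apply: eq_bigr => q _.
by rewrite mulrC.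
Qed.

(** An operator with image in [g] has the same trace on the whole space as on [g]: expand its values
    on the matrix units in the basis of [g], exchange the sums, and reassemble the basis vectors. *)
Lemma trace_on_subspace (g : {vspace M}) (f : M -> M) (F : 'End(M)) :
    (forall X, F X \in g) -> {in g, F =1 f} ->
  \sum_(i < \dim g) coord (vbasis g) i (f (vbasis g)`_i) = mx_lfun_trace F.
Proof.
move=> Fg Ff; rewrite /mx_lfun_trace.
under [RHS]eq_bigr => i _ do under eq_bigr => j _ do
  rewrite (coord_vbasis (Fg (delta_mx i j))) summxE.
under [RHS]eq_bigr => i _ do rewrite exchange_big.
rewrite exchange_big; apply: eq_bigr => k _ /=.
rewrite -Ff; last by apply: vbasis_mem; rewrite mem_nth ?size_tuple.
rewrite {1}[(vbasis g)`_k]matrix_sum_delta !linear_sum; apply: eq_bigr => i _.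
rewrite !linear_sum; apply: eq_bigr => j _.
by rewrite !linearZ /= mxE mulrC.
Qed.

Lemma eq_mx_lfun_trace (f g : M -> M) : f =1 g ->
  mx_lfun_trace f = mx_lfun_trace g.
Proof. by move=> /funext ->. Qed.

Lemma mx_lfun_traceB (f g : M -> M) :
  mx_lfun_trace (fun Z => f Z - g Z) = mx_lfun_trace f - mx_lfun_trace g.
Proof.
rewrite -sumrB; apply: eq_bigr => i _; rewrite -sumrB; apply: eq_bigr => j _.
by rewrite !linmxE.
Qed.

Lemma mx_lfun_traceZ c (f : M -> M) :
  mx_lfun_trace (fun Z => c *: f Z) = c * mx_lfun_trace f.
Proof.
rewrite mulr_sumr; apply: eq_bigr => i _; rewrite mulr_sumr.
by apply: eq_bigr => j _; rewrite linmxE.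
Qed.

Lemma mx_lfun_trace_mul (A B : M) :
  mx_lfun_trace (fun Z => A *m Z *m B) = \tr A * \tr B.
Proof.
rewrite /mx_lfun_trace /mxtrace mulr_suml; apply: eq_bigr => i _.
rewrite mulr_sumr; apply: eq_bigr => j _.
rewrite mxE (bigD1 j) //= big1 ?addr0 => [|k kj].
  rewrite mxE (bigD1 i) //= big1 ?addr0 => [|k ki].
    by rewrite mxE !eqxx mulr1.
  by rewrite mxE (negPf ki) mulr0.
rewrite mxE big1 ?mul0r // => m _.
by rewrite mxE (negPf kj) andbF mulr0.
Qed.

Lemma mx_lfun_trace_mul_tr (A B : M) :
  mx_lfun_trace (fun Z => A *m Z^T *m B) = \tr (A *m B^T).
Proof.
rewrite /mx_lfun_trace /mxtrace; apply: eq_bigr => i _.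
rewrite mxE; apply: eq_bigr => j _.
rewrite trmx_delta mxE (bigD1 i) //= big1 ?addr0 => [|k ki].
  rewrite mxE (bigD1 j) //= big1 ?addr0 => [|k kj].
    by rewrite !mxE !eqxx mulr1.
  by rewrite mxE (negPf kj) mulr0.
rewrite mxE big1 ?mul0r // => m _.
by rewrite mxE (negPf ki) andbF mulr0.
Qed.

End OperatorTrace.

Section Killing.
Variables (R : realType) (l : nat) (g : {vspace 'M[R]_l.+1}).
Hypothesis gP : forall X, X \in g <-> skew X.
Local Notation M := 'M[R]_l.+1.
Local Notation eta := (form_mx R l).

Lemma skew_ad (X Y : M) : skew X -> skew Y -> skew (ad X Y).
Proof.
move=> sX sY x y; rewrite adE !mulmxBl !bformD -!mulmxA !sX !sY !sX; lra.
Qed.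

(** Up to a factor 2 this is the projection onto the skew matrices along those that are self-adjoint
    for the form. *)
Lemma skew_part (Z : M) : skew (Z - eta *m Z^T *m eta).
Proof.
apply/skewP; rewrite linearB /= !trmx_mul trmxK eta_tr mulmxBl mulmxBr.
rewrite -!mulmxA eta_sqr mulmx1 !mulmxA eta_sqr mul1mx.
by rewrite addrA subrK subrr.
Qed.

Lemma killing_trace X Y (F : 'End(M)) : (forall Z, F Z \in g) ->
  {in g, forall Z, F Z = ad X (ad Y Z)} -> killing g X Y = mx_lfun_trace F.
Proof. exact: trace_on_subspace. Qed.

(** The classical value [(N - 2) tr(XY)] for the orthogonal algebra in dimension [N = l + 1]. It is
    found by precomposing [ad X] and [ad Y] with the projection onto skew matrices, whose trace on
    the matrix space splits into elementary terms. *)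
Lemma killing_mxtrace X Y : X \in g -> Y \in g ->
  killing g X Y = l%:R * \tr (X *m Y) - \tr (X *m Y).
Proof.
move=> gX gY; have sX := (gP X).1 gX; have sY := (gP Y).1 gY.
have HE Z : ad X (ad Y Z) = X *m Y *m Z *m 1%:M - X *m Z *m Y
    - (Y *m Z *m X - 1%:M *m Z *m (Y *m X)).
  by rewrite !adE mulmxBr mulmxBl mulmx1 mul1mx !mulmxA.
have HL (Z W : M) : ad X (ad Y (2^-1 *: (Z - W))) =
    2^-1 *: (ad X (ad Y Z) - ad X (ad Y W)).
  by rewrite linearZ linearZ linearB linearB.
pose F := fun Z => ad X (ad Y (2^-1 *: (Z - eta *m Z^T *m eta))).
have linF : linear F.
  move=> c A B; rewrite /F -!linearP; congr (ad _ (ad _ _)).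
  have -> : (c *: A + B)^T = c *: A^T + B^T by apply/matrixP => i j; rewrite !mxE.
  rewrite mulmxDr mulmxDl -scalemxAr -scalemxAl.
  by apply/matrixP => i j; rewrite !linmxE; ring.
pose F' : {linear M -> M} := HB.pack F (GRing.isLinear.Build _ _ _ _ F linF).
have F'E Z : linfun F' Z = F Z by rewrite lfunE.
rewrite (@killing_trace _ _ (linfun F')).
- rewrite (@eq_mx_lfun_trace _ _ _ (fun Z => 2^-1 *:
    (((X *m Y) *m Z *m 1%:M - X *m Z *m Y - (Y *m Z *m X - 1%:M *m Z *m (Y *m X))) -
     ((X *m Y *m eta) *m Z^T *m eta - (X *m eta) *m Z^T *m (eta *m Y)
      - ((Y *m eta) *m Z^T *m (eta *m X) - eta *m Z^T *m (eta *m Y *m X))))));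
    last by move=> Z; rewrite F'E /F HL !HE !mulmx1 !mul1mx !mulmxA.
  rewrite mx_lfun_traceZ !mx_lfun_traceB !mx_lfun_trace_mul !mx_lfun_trace_mul_tr.
  have E (A B : M) : skew B -> A *m eta *m (eta *m B)^T = - (A *m B).
    by move=> sB; rewrite trmx_mul eta_tr -mulmxA (mulmxA eta) skew_eta // mulmxN.
  have -> : eta *m (eta *m Y *m X)^T = X *m Y.
    rewrite trmx_mul trmx_mul eta_tr.
    transitivity ((eta *m X^T *m eta) *m (eta *m Y^T *m eta)).
      by rewrite -!mulmxA (mulmxA eta eta) eta_sqr mul1mx.
    by rewrite !skew_eta // mulNmx mulmxN opprK.
  have trN (A : M) : \tr (- A) = - \tr A by rewrite linearN.
  rewrite eta_tr -(mulmxA _ eta eta) eta_sqr mulmx1 (E X Y sY) (E Y X sX) !trN.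
  rewrite (mxtrace_mulC Y X) (skew_tr0 sX) (skew_tr0 sY) mxtrace1 -natr1.
  by field.
- move=> Z; rewrite F'E /F; apply/gP; do 2 (apply: skew_ad => //).
  by apply/gP; rewrite memvZ //; apply/gP/skew_part.
- move=> Z /gP sZ; rewrite F'E /F; congr (ad _ (ad _ _)).
  rewrite skew_eta // opprK; apply/matrixP => i j; rewrite !linmxE; lra.
Qed.

(** On [g] the operator for [f X] and [f Y] is the conjugate by [f] of the one for [X] and [Y], and
    the trace is invariant under cyclic permutation. *)
Lemma killing_automorphism f X Y : involutive_automorphism g f ->
  X \in g -> Y \in g -> killing g (f X) (f Y) = killing g X Y.
Proof.
move=> [fg fad ff] gX gY.
have gf Z : Z \in g -> f Z \in g by move=> gZ; rewrite -fg memv_img.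
have gad Z W : Z \in g -> W \in g -> ad Z W \in g.
  by move=> /gP sZ /gP sW; apply/gP/skew_ad.
(* The automorphism is controlled only on [g], so the operators are made to factor through the
   projection onto [g] before traces on the whole matrix space are taken. *)
pose P := projv g; have Pg Z : P Z \in g by exact: memv_proj.
have PK Z : Z \in g -> P Z = Z by exact: projv_id.
pose a : 'End(M) := (ad X \o (ad Y \o (P \o (f \o P))))%VF.
have aE Z : a Z = ad X (ad Y (P (f (P Z)))) by rewrite !comp_lfunE.
rewrite (@killing_trace _ _ (f \o a)%VF).
- rewrite (@killing_trace _ _ (a \o f)%VF).
  + have := mx_lfun_trace_comp f a; rewrite /mx_lfun_trace => E.
    under eq_bigr => i _ do under eq_bigr => j _ do rewrite comp_lfunE.
    by under [RHS]eq_bigr => i _ do under eq_bigr => j _ do rewrite comp_lfunE.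
  + by move=> Z; rewrite comp_lfunE aE !gad.
  + by move=> Z gZ; rewrite comp_lfunE aE !PK ?ff ?gf.
- by move=> Z; rewrite comp_lfunE aE gf // !gad.
- by move=> Z gZ; rewrite comp_lfunE aE !PK ?gf // !fad ?gad ?gf // ff.
Qed.

End Killing.

(** * Positive definite matrices and isotropic subspaces *)

Section PositiveForms.
Variable R : realType.

(** Induction on the size through the Schur complement [D']. It is again positive: its value at [y]
    is the value of [S] at the vector over [y] whose first coordinate completes the square. *)
Lemma cholesky n (S : 'M[R]_n) : S^T = S ->
    (forall x : 'cV[R]_n, x != 0 -> 0 < (x^T *m S *m x) 0 0) ->
  exists C : 'M[R]_n, S = C^T *m C.
Proof.
elim: n S => [|n IH] S symS posS.
  by exists 0; apply/matrixP => -[].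
pose a := S 0 0; pose b : 'rV[R]_n := @ursubmx _ 1 n 1 n S.
pose D : 'M[R]_n := @drsubmx _ 1 n 1 n S.
have SE : S = block_mx (a%:M : 'M[R]_1) b b^T D.
  have E1 : @ulsubmx _ 1 n 1 n S = a%:M.
    by rewrite [LHS]mx11_scalar; congr (_%:M); rewrite !mxE; congr (S _ _); apply/val_inj.
  have E2 : @dlsubmx _ 1 n 1 n S = b^T by rewrite /b trmx_ursub symS.
  by rewrite -E1 -E2 [RHS](@submxK _ 1 n 1 n).
have posB (x : 'cV[R]_(1 + n)) : x != 0 ->
    0 < (x^T *m block_mx (a%:M : 'M[R]_1) b b^T D *m x) 0 0.
  by rewrite -SE; exact: posS.
have a0 : 0 < a.
  have := posS (delta_mx 0 0); rewrite trmx_delta -rowE -colE !mxE; apply.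
  by apply/eqP => /matrixP/(_ 0 0)/eqP; rewrite !mxE eqxx oner_eq0.
have DT : D^T = D by rewrite /D trmx_drsub symS.
pose D' := D - a^-1 *: (b^T *m b).
have [|y y0|C' C'E] := IH D'.
- by rewrite /D' linearB linearZ /= DT trmx_mul trmxK.
- pose x : 'cV[R]_(1 + n) := col_mx (- a^-1 *: (b *m y)) y.
  have x0 : x != 0.
    apply: contra y0 => /eqP x0; have := congr1 (@dsubmx _ 1 n 1) x0.
    by rewrite col_mxKd linear0 => ->.
  have := posB x x0; rewrite [in X in _ -> X]/D'.
  suff -> : x^T *m block_mx (a%:M : 'M[R]_1) b b^T D *m x =
      y^T *m (D - a^-1 *: (b^T *m b)) *m y by [].
  rewrite /x tr_col_mx mul_row_block mul_row_col.
  have tT : (- a^-1 *: (b *m y))^T = - a^-1 *: (y^T *m b^T).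
    by rewrite -trmx_mul; apply/matrixP => p q; rewrite !mxE.
  rewrite mul_mx_scalar tT scalerA mulrN divff ?gt_eqF // scaleN1r addNr mul0mx.
  rewrite add0r mulmxBr !mulmxDl mulNmx -!scalemxAr -!scalemxAl scaleNr addrC.
  by rewrite !mulmxA.
have s0 : Num.sqrt a != 0 by rewrite sqrtr_eq0 -ltNge.
have ss : Num.sqrt a * Num.sqrt a = a by rewrite -expr2 sqr_sqrtr // ltW.
pose c : 'M[R]_1 := (Num.sqrt a)%:M; pose r : 'rV[R]_n := (Num.sqrt a)^-1 *: b.
pose C : 'M[R]_(1 + n) := block_mx c r 0 C'.
suff CE : C^T *m C = block_mx (a%:M : 'M[R]_1) b b^T D by exists C; rewrite -SE in CE.
have rT : r^T = (Num.sqrt a)^-1 *: b^T by apply/matrixP => p q; rewrite !mxE.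
rewrite /C tr_block_mx mulmx_block trmx0 !mul0mx mulmx0 !addr0 -C'E rT /c /r.
rewrite tr_scalar_mx -scalar_mxM ss mul_scalar_mx scalerA divff // scale1r.
rewrite mul_mx_scalar scalerA divff // scale1r.
rewrite -scalemxAl -scalemxAr scalerA -invfM ss /D'.
by rewrite addrCA subrr addr0.
Qed.

Lemma mxtrace_gram_ge0 m n (A : 'M[R]_(m, n)) : 0 <= \tr (A *m A^T).
Proof.
rewrite /mxtrace; apply: sumr_ge0 => i _; rewrite mxE; apply: sumr_ge0 => j _.
by rewrite mxE -expr2 sqr_ge0.
Qed.

(** Three rows of length 2 are linearly dependent. With the two positive coordinates as [i] and [j],
    this makes any three vectors meet the negative definite coordinate subspace. *)
Lemma ex_vanishing_combination n (a b c : 'cV[R]_n) (i j : 'I_n) :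
  exists al be ga : R, [|| al != 0, be != 0 | ga != 0] /\
    forall k, k \in [:: i; j] -> (al *: a + be *: b + ga *: c) k 0 = 0.
Proof.
pose A : 'M[R]_(3, 2) := \matrix_(p, q)
  (nth 0 [:: a; b; c] p) (if q == 0 then i else j) 0.
have : kermx A != 0.
  rewrite kermx_eq0 /row_free; apply: contraL (rank_leq_col A) => /eqP ->.
  by [].
rewrite -nz_row_eq0 => s0; set s := nz_row _ in s0.
have sA : s *m A = 0 by apply/sub_kermxP; exact: nz_row_sub.
pose i1 : 'I_3 := lift ord0 ord0; pose i2 : 'I_3 := lift ord0 (lift ord0 ord0).
exists (s 0 ord0), (s 0 i1), (s 0 i2); split.
  apply: contraR s0; rewrite !negb_or !negbK => /and3P[/eqP s0 /eqP s1 /eqP s2].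
  apply/eqP/rowP => p; rewrite mxE.
  case: (unliftP ord0 p) => [p' ->|-> //].
  case: (unliftP ord0 p') => [p'' ->|-> //].
  by rewrite (ord1 p'').
have sum3 (q : 'I_2) k : k = (if q == 0 then i else j) ->
    (s 0 ord0 *: a + s 0 i1 *: b + s 0 i2 *: c) k 0 = 0.
  move=> ->; have /rowP/(_ q) := sA.
  by rewrite !mxE !big_ord_recl big_ord0 !mxE /= addr0 addrA.
move=> k; rewrite !inE => /orP[/eqP ->|/eqP ->].
  exact: (sum3 0).
exact: (sum3 1).
Qed.

End PositiveForms.

Section Signature.
Variables (R : realType) (l : nat).
Hypothesis l_ge3 : (3 <= l)%N.
Local Notation V := 'cV[R]_l.+1.
Local Notation "<[ x , y ]>" := (bform x y) (at level 0, x, y at level 99).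

Lemma bform_negative (z : V) : (forall i : 'I_l.+1, (i < 2)%N -> z i 0 = 0) ->
  <[z, z]> <= 0 /\ (<[z, z]> = 0 -> z = 0).
Proof.
move=> z2.
have E : <[z, z]> = - \sum_i z i 0 ^+ 2.
  rewrite bformE -sumrN; apply: eq_bigr => i _; rewrite /sgn; case: ifP => i2.
    by rewrite z2 // expr0n !mulr0 oppr0.
  by rewrite mulN1r expr2.
have S0 : forall i, true -> 0 <= z i 0 ^+ 2 by move=> i _; exact: sqr_ge0.
rewrite E oppr_le0; split; first exact: sumr_ge0.
move=> /eqP; rewrite oppr_eq0 psumr_eq0 // => /allP H; apply/colP => i.
by have := H i (mem_index_enum i); rewrite sqrf_eq0 mxE => /eqP.
Qed.

(** The coefficients are nontrivial, but the combination may be the zero vector, since the three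
    vectors are not assumed independent. *)
Lemma ex_negative_combination (a b c : V) : exists al be ga : R,
  [/\ [|| al != 0, be != 0 | ga != 0],
    let z := al *: a + be *: b + ga *: c in <[z, z]> <= 0 &
    let z := al *: a + be *: b + ga *: c in <[z, z]> = 0 -> z = 0].
Proof.
have l1 : (1 < l.+1)%N by apply: (@leq_trans 4).
have [al [be [ga [nz H]]]] := ex_vanishing_combination a b c ord0 (Ordinal l1).
exists al, be, ga; split=> //=.
  by have [] := @bform_negative (al *: a + be *: b + ga *: c) => // i i2; apply: H;
    rewrite !inE -!val_eqE /=; case: (i : nat) i2 => [|[]].
have [] // := @bform_negative (al *: a + be *: b + ga *: c) => i i2; apply: H.
by rewrite !inE -!val_eqE /=; case: (i : nat) i2 => [|[]].
Qed.

(** If [x] were orthogonal to [f] as well, any combination of [x], [e], [f] would have norm the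
    square of its first coefficient. The combination of nonpositive norm is then zero with first
    coefficient 0; pairing it with [v] kills the coefficient of [f], and [e != 0] kills the last
    one. *)
Lemma isotropic_plane_maximal (v e f x : V) :
    <[e, e]> = 0 -> <[f, f]> = 0 -> <[e, f]> = 0 -> <[e, v]> = 0 ->
    <[f, v]> != 0 -> e != 0 -> <[x, x]> = 1 -> <[e, x]> = 0 -> <[f, x]> != 0.
Proof.
move=> ee ff ef ev fv e0 xx ex; apply/eqP => fx.
have [al [be [ga [nz]]]] := ex_negative_combination x e f; cbv zeta.
set z := _ + _ => zle0 z0.
have zz : <[z, z]> = al ^+ 2.
  by rewrite /z !bformD !(bformC x) (bformC f e) ee ff ef ex fx xx; ring.
have al0 : al = 0.
  by apply/eqP; rewrite -sqrf_eq0 eq_le sqr_ge0 -zz zle0.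
have {}z0 : z = 0 by apply: z0; rewrite zz al0 expr0n.
have : <[z, v]> = 0 by rewrite z0 bform0l.
rewrite /z al0 !bformD ev mul0r mulr0 !add0r => /eqP.
rewrite mulf_eq0 (negPf fv) orbF => /eqP ga0.
move: z0 nz; rewrite /z al0 ga0 !scale0r add0r addr0 eqxx /= orbF => /eqP.
by rewrite scaler_eq0 (negPf e0) orbF => ->.
Qed.

(** A vector of nonnegative norm would extend the positive plane of [v] and [w] to three orthogonal
    directions, none negative, against the signature. *)
Lemma positive_plane_orthogonal (v w x : V) : <[v, v]> = 1 -> <[w, w]> = 1 ->
    <[v, w]> = 0 -> <[v, x]> = 0 -> <[w, x]> = 0 -> x != 0 -> <[x, x]> < 0.
Proof.
move=> vv ww vw vx wx x0; rewrite ltNge; apply/negP => xx.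
have [al [be [ga [nz]]]] := ex_negative_combination x v w; cbv zeta.
set z := _ + _ => zle0 z0.
have zz : <[z, z]> = al ^+ 2 * <[x, x]> + be ^+ 2 + ga ^+ 2.
  by rewrite /z !bformD !(bformC x) (bformC w v) vv ww vw vx wx; ring.
have p1 : 0 <= al ^+ 2 * <[x, x]> by rewrite mulr_ge0 ?sqr_ge0.
have p2 := sqr_ge0 be; have p3 := sqr_ge0 ga.
have b0 : be = 0 by apply/eqP; rewrite -sqrf_eq0; apply/eqP; lra.
have g0 : ga = 0 by apply/eqP; rewrite -sqrf_eq0; apply/eqP; lra.
have /z0 : <[z, z]> = 0 by lra.
move: nz; rewrite /z b0 g0 !scale0r !addr0 eqxx /= orbF => a0 /eqP.
by rewrite scaler_eq0 (negPf a0) (negPf x0).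
Qed.

End Signature.

(** * Restricted roots *)

(* The data about [a] and [n] that determine the orbits of [A N]: a full isotropic
   flag [e], [f], orthogonal to [v] only at its first step, of joint eigenvectors
   of [a] that [n] shifts downwards. *)
Record flag_data (R : realType) (l : nat) (v e f : 'cV[R]_l.+1)
    (a n : {vspace 'M[R]_l.+1}) : Prop := FlagData {
  flag_ee : bform e e = 0;
  flag_ff : bform f f = 0;
  flag_ef : bform e f = 0;
  flag_ev : bform e v = 0;
  flag_fv : bform f v != 0;
  flag_e_neq0 : e != 0;
  flag_a : forall X, X \in a -> exists s t, X *m e = s *: e /\ X *m f = t *: f;
  flag_ae : forall s, exists2 X, X \in a & X *m e = s *: e;
  flag_af : forall t, exists2 X, X \in a & X *m f = t *: f;
  flag_n : forall X, X \in n -> X *m e = 0 /\ exists c, X *m f = c *: e;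
  flag_ne : forall z, bform e z = 0 -> wedge e z \in n;
  flag_nf : forall z, bform e z = 0 -> bform f z = 0 -> wedge f z \in n }.

Section RootVectors.
Variables (R : realType) (l : nat).
Local Notation M := 'M[R]_l.+1.
Local Notation V := 'cV[R]_l.+1.
Local Notation "<[ x , y ]>" := (bform x y) (at level 0, x, y at level 99).

Lemma mem_leigenspace (f : 'End(M)) c X :
  X \in passmx.leigenspace f c <-> f X = c *: X.
Proof.
rewrite /passmx.leigenspace memv_ker add_lfunE opp_lfunE scale_lfunE id_lfunE subr_eq0.
by split=> /eqP.
Qed.

Lemma mem_eigensubspace (g : {vspace M}) (f : 'End(M)) c X :
  X \in eigensubspace g f c <-> X \in g /\ f X = c *: X.
Proof.
rewrite /eigensubspace memv_cap; split=> [/andP[-> /mem_leigenspace]//|[-> ?]].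
exact/mem_leigenspace.
Qed.

Lemma mem_root_space (g : {vspace M}) (J1 J2 : M) al be X :
  X \in root_space g J1 J2 al be <->
  [/\ X \in g, ad J1 X = al *: X & ad J2 X = be *: X].
Proof.
rewrite /root_space !memv_cap; split=> [/andP[/andP[gX H1] H2]|[gX H1 H2]].
  by split=> //; [apply: (mem_leigenspace _ _ _).1 H1 | apply: (mem_leigenspace _ _ _).1 H2].
by apply/andP; split; [apply/andP; split=> //|]; exact/mem_leigenspace.
Qed.

Lemma adE_col (X Y : M) (y : V) : ad X Y *m y = X *m (Y *m y) - Y *m (X *m y).
Proof. by rewrite adE mulmxBl -!mulmxA. Qed.

Lemma bform_eqP (x y : V) : (forall z, <[z, x]> = <[z, y]>) -> x = y.
Proof.
move=> H; apply/eqP; rewrite -subr_eq0; apply/eqP/bform_nondegenerate => z.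
by rewrite bformBr H subrr.
Qed.

(* [wedge u v] has at most two nonzero weights on vectors, both simple, so a skew [X]
   of weight [eps] must exchange the kernel of [wedge u v] and its weight lines. *)
Lemma weight_wedge (u v : V) (X : M) eps :
    skew X -> <[v, v]> = 1 -> <[u, v]> = 0 -> eps * eps = 1 ->
    ad (wedge u v) X = eps *: X ->
  [/\ X = wedge (X *m v) (v + eps *: u), <[u, X *m v]> = 0 &
      - <[u, u]> *: (X *m v) = X *m v].
Proof.
move=> sX vv uv ee adX.
have vu : <[v, u]> = 0 by rewrite bformC.
have E (y : V) : wedge u v *m (X *m y) - X *m (wedge u v *m y) = eps *: (X *m y).
  by rewrite -adE_col adX -scalemxAl.
have Jv : wedge u v *m v = u by rewrite wedgeE vv uv scale1r scale0r subr0.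
have Ju : wedge u v *m u = - <[u, u]> *: v.
  by rewrite wedgeE vu scale0r sub0r scaleNr.
have uXv : <[u, X *m v]> = 0.
  have := congr1 (bform u) (E v); rewrite Jv wedgeE !bformD !(skew0 _ sX) uv.
  move=> H; have : eps * (eps * <[u, X *m v]>) = 0 by rewrite -H; ring.
  by rewrite mulrA ee mul1r.
have vXu : <[v, X *m u]> = 0 by rewrite -[LHS]opprK -sX bformC uXv oppr0.
have Xu : X *m u = - eps *: (X *m v).
  have := E v; rewrite Jv wedgeE skew0 // uXv !scale0r subr0 sub0r => H.
  by rewrite scaleNr -H opprK.
have Xuv : - <[u, u]> *: (X *m v) = X *m v.
  have := E u; rewrite Ju wedgeE skew0 // vXu !scale0r subr0 sub0r Xu -scalemxAr.
  by rewrite scalerA mulrN ee scaleN1r => /oppr_inj.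
split=> //; apply: eq_mulmx_col => y.
have Xy : X *m y = eps *: (eps *: (X *m y)) by rewrite scalerA ee scale1r.
rewrite {1}Xy -E !wedgeE mulmxBr -!scalemxAr Xu.
have H1 : <[v, X *m y]> = - <[X *m v, y]> by rewrite sX opprK.
have H2 : <[u, X *m y]> = eps * <[X *m v, y]>.
  have := sX u y; rewrite Xu bformZl => H; lra.
rewrite H1 H2; apply/colP => i; rewrite !linmxE !bformD.
ring: ee.
Qed.

End RootVectors.

(** * Wedge expressions for [J1], [J2] and the root vectors *)

Section Structure.
Variables (R : realType) (l : nat).
Local Notation M := 'M[R]_l.+1.
Local Notation V := 'cV[R]_l.+1.
Local Notation eta := (form_mx R l).
Local Notation "<[ x , y ]>" := (bform x y) (at level 0, x, y at level 99).
Variables (v : V) (g h a : {vspace M}) (sigma theta : 'End(M)).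
Variables (J1 J2 X : M).
Hypotheses (l_ge3 : (3 <= l)%N) (v_norm : <[v, v]> = 1).
Hypothesis gP : forall Y, Y \in g <-> skew Y.
Hypothesis hP : forall Y, Y \in h <-> skew Y /\ Y *m v = 0.
Hypothesis sigma_inv : involutive_automorphism g sigma.
Hypothesis sigma_h : eigensubspace g sigma 1 = h.
Hypothesis theta_cartan : cartan_involution g theta.
Hypothesis theta_sigma : forall Y, Y \in g -> theta (sigma Y) = sigma (theta Y).
Hypothesis theta_J1 : theta J1 = - J1.
Hypothesis theta_J2 : theta J2 = - J2.
Hypotheses (J2_neq0 : J2 != 0).
Hypothesis J1_h : J1 \in h.
Hypothesis J2_q : J2 \in eigensubspace g sigma (-1).
Hypothesis J12 : ad J1 J2 = 0.
Hypothesis X_root : X \in root_space g J1 J2 1 1.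
Hypothesis X_norm : ad (theta X) X = 4 *: (J1 + J2).

(** The two eigenspaces of [sigma] are orthogonal for the invariant Killing form. Testing [Y]
    against the wedges of vectors orthogonal to [v], which lie in [h], shows that [Y] has no
    coefficient inside that orthogonal. *)
Lemma sigma_neg_wedge Y : Y \in g -> sigma Y = - Y -> Y = wedge (Y *m v) v.
Proof.
move=> gY sY; have kY := (gP Y).1 gY.
have ortho b c : <[b, v]> = 0 -> <[c, v]> = 0 -> <[b, Y *m c]> = 0.
  move=> bv cv; pose W : M := wedge c b.
  have hW : W \in h.
    apply/hP; split; first exact: skew_wedge.
    by rewrite wedgeE bv cv !scale0r subr0.
  have [gW sW] : W \in g /\ sigma W = 1 *: W.
    by apply/mem_eigensubspace; rewrite sigma_h.
  have := killing_automorphism gP sigma_inv gY gW.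
  rewrite sY sW scale1r => K.
  have : killing g Y W = 0.
    have : killing g (- Y) W = - killing g Y W.
      rewrite !(killing_mxtrace gP) ?memvN // mulNmx linearN /=; ring.
    by rewrite K => ?; lra.
  rewrite (killing_mxtrace gP) // mxtrace_mul_wedge.
  have := kY b c; rewrite bformC => ->.
  have l1 : (l%:R : R) - 1 != 0.
    by rewrite subr_eq0 -[1]/(1%:R) eqr_nat; case: (l) l_ge3 => [|[]].
  rewrite opprK => H; have : (l%:R - 1) * (2 * <[b, Y *m c]>) = 0 by rewrite -[RHS]H; ring.
  by move=> /eqP; rewrite mulf_eq0 (negPf l1) /= mulf_eq0 pnatr_eq0 /= => /eqP.
apply: eq_mulmx_col => x; apply: bform_eqP => y.
(* Project both vectors onto the orthogonal of [v]; what remains of [Y] are its coefficients against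
   [v]. *)
have := ortho (y - <[v, y]> *: v) (x - <[v, x]> *: v).
rewrite !bformD v_norm !(bformC v) !mulr1 !subrr => /(_ erefl erefl).
rewrite !mulmxBr -!scalemxAr !bformD.
rewrite (kY x v) (kY v v) (skew0 _ kY) => H.
by rewrite wedgeE !bformD (bformC v x) (bformC (Y *m v)); lra.
Qed.

Let sigmaK Y : Y \in g -> sigma (sigma Y) = Y.
Proof. by case: sigma_inv => _ _; apply. Qed.

Let sigma_mem Y : Y \in g -> sigma Y \in g.
Proof. by case: sigma_inv => E _ _ gY; rewrite -E memv_img. Qed.

(** This is conjugation by the reflection that negates [v]: [Y + sigma Y] lies in [h] and kills [v],
    while [Y - sigma Y] is a wedge with [v]. *)
Lemma sigmaE Y : Y \in g -> sigma Y = Y - 2 *: wedge (Y *m v) v.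
Proof.
move=> gY; have gsY := sigma_mem gY.
have Pv : (Y + sigma Y) *m v = 0.
  apply: (proj2 ((hP _).1 _)); rewrite -sigma_h; apply/mem_eigensubspace.
  by rewrite memvD // linearD /= sigmaK // scale1r addrC.
have := @sigma_neg_wedge (Y - sigma Y); rewrite memvB // linearB /= sigmaK // opprB.
move=> /(_ isT erefl); rewrite mulmxBl.
have -> : sigma Y *m v = - (Y *m v).
  by apply/eqP; rewrite -addr_eq0 addrC -mulmxDl Pv.
rewrite opprK -mulr2n -scaler_nat wedgeZl => <-.
by rewrite opprB addrCA subrr addr0.
Qed.

Let u := J2 *m v.
Let e0 := X *m v.
Let e1 := theta X *m v.

Let thetaK Y : Y \in g -> theta (theta Y) = Y.
Proof. by case: theta_cartan => -[_ _ H] _; exact: H. Qed.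

Let theta_mem Y : Y \in g -> theta Y \in g.
Proof. by case: theta_cartan => -[E _ _] _ gY; rewrite -E memv_img. Qed.

Let theta_ad Y Z : Y \in g -> Z \in g -> theta (ad Y Z) = ad (theta Y) (theta Z).
Proof. by case: theta_cartan => -[_ H _] _; exact: H. Qed.

Let gX : X \in g. Proof. by have [] := (mem_root_space _ _ _ _ _ _).1 X_root. Qed.
Let gX' : theta X \in g. Proof. exact: theta_mem. Qed.
Let gJ1 : J1 \in g. Proof. by apply/gP; case: ((hP J1).1 J1_h). Qed.
Let gJ2 : J2 \in g. Proof. by case: ((mem_eigensubspace _ _ _ _).1 J2_q). Qed.
Let kX := (gP X).1 gX.
Let kX' := (gP _).1 gX'.
Let kJ1 := (gP J1).1 gJ1.
Let kJ2 := (gP J2).1 gJ2.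

Let J1v : J1 *m v = 0. Proof. by case: ((hP J1).1 J1_h). Qed.

Lemma J2_wedge : J2 = wedge u v.
Proof.
apply: sigma_neg_wedge => //.
by case: ((mem_eigensubspace _ _ _ _).1 J2_q) => _ ->; rewrite scaleN1r.
Qed.

Let uv0 : <[u, v]> = 0.
Proof. by rewrite bformC skew0. Qed.

Let J1u : J1 *m u = 0.
Proof.
have := adE_col J1 J2 v.
by rewrite J12 mul0mx J1v mulmx0 subr0.
Qed.

Let adJ1X : ad J1 X = X.
Proof. by have [_ -> _] := (mem_root_space _ _ _ _ _ _).1 X_root; rewrite scale1r. Qed.
Let adJ2X : ad J2 X = X.
Proof. by have [_ _ ->] := (mem_root_space _ _ _ _ _ _).1 X_root; rewrite scale1r. Qed.

Let ad_opp (Y Z : M) : ad (- Y) Z = - ad Y Z.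
Proof. by rewrite !adE mulNmx mulmxN opprB addrC opprK. Qed.

Let adJ1X' : ad J1 (theta X) = - theta X.
Proof.
by have := theta_ad gJ1 gX; rewrite theta_J1 adJ1X ad_opp => {2}->; rewrite opprK.
Qed.
Let adJ2X' : ad J2 (theta X) = - theta X.
Proof.
by have := theta_ad gJ2 gX; rewrite theta_J2 adJ2X ad_opp => {2}->; rewrite opprK.
Qed.

Let weightX : [/\ X = wedge e0 (v + 1 *: u), <[u, e0]> = 0 & - <[u, u]> *: e0 = e0].
Proof.
apply: weight_wedge => //; [by rewrite mulr1 |].
by rewrite -J2_wedge adJ2X scale1r.
Qed.

Let weightX' : [/\ theta X = wedge e1 (v + (-1) *: u), <[u, e1]> = 0 &
  - <[u, u]> *: e1 = e1].
Proof.
apply: weight_wedge => //; [by rewrite mulrNN mulr1 |].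
by rewrite -J2_wedge adJ2X' scaleN1r.
Qed.

Lemma X_wedge : X = wedge e0 (v + u).
Proof. by case: weightX => {1}-> _ _; rewrite scale1r. Qed.

Lemma theta_X_wedge : theta X = wedge e1 (v - u).
Proof. by case: weightX' => {1}-> _ _; rewrite scaleN1r. Qed.

(** Otherwise [X] vanishes and its normalization gives [J1 + J2 = 0]; as [J1] kills [v], so does
    [J2], whence [J2 = 0]. *)
Let e0_neq0 : e0 != 0.
Proof.
apply: contra J2_neq0 => /eqP E.
have X0 : X = 0 by rewrite X_wedge E -(scale0r (0 : V)) wedgeZl scale0r.
have : 4 *: (J1 + J2) = 0 by rewrite -X_norm X0 linear0.
move=> /eqP; rewrite scaler_eq0 pnatr_eq0 /= => /eqP J0.
have u0 : u = 0 by rewrite /u -[J2](addKr J1) J0 addr0 mulNmx J1v oppr0.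
by rewrite J2_wedge u0 -(scale0r (0 : V)) wedgeZl scale0r.
Qed.

Let uu : <[u, u]> = -1.
Proof.
case: weightX => _ _ /eqP; rewrite -[X in _ == X]scale1r -subr_eq0 -scalerBl.
by rewrite scaler_eq0 (negPf e0_neq0) orbF => /eqP ?; lra.
Qed.

Let e0u : <[e0, u]> = 0. Proof. by case: weightX => _ + _; rewrite bformC. Qed.
Let e1u : <[e1, u]> = 0. Proof. by case: weightX' => _ + _; rewrite bformC. Qed.
Let e0v : <[e0, v]> = 0. Proof. by rewrite bformC skew0. Qed.
Let e1v : <[e1, v]> = 0. Proof. by rewrite bformC skew0. Qed.

Let J1e0 : J1 *m e0 = e0.
Proof. by have := adE_col J1 X v; rewrite adJ1X J1v mulmx0 subr0. Qed.

Let J1e1 : J1 *m e1 = - e1.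
Proof.
by have := adE_col J1 (theta X) v; rewrite adJ1X' J1v mulmx0 subr0 mulNmx.
Qed.

Let e0e0 : <[e0, e0]> = 0.
Proof. by rewrite -[X in <[_, X]>]J1e0 skew0. Qed.

Let e1e1 : <[e1, e1]> = 0.
Proof. by apply: oppr_inj; rewrite oppr0 -bformNr -J1e1 skew0. Qed.

Let bracket (y : V) :
  theta X *m (X *m y) - X *m (theta X *m y) = 4 *: (J1 *m y) + 4 *: (J2 *m y).
Proof. by rewrite -adE_col X_norm -scalemxAl mulmxDl scalerDr. Qed.

Let gram := (v_norm, uv0, uu, e0u, e1u, e0v, e1v, e0e0, e1e1, bformC v e0,
  bformC v e1, bformC u e0, bformC u e1, bformC v u).

Let X_col (y : V) : X *m y = <[v + u, y]> *: e0 - <[e0, y]> *: (v + u).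
Proof. by have /(congr1 (mulmx^~ y)) := X_wedge; rewrite /= wedgeE. Qed.

Let X'_col (y : V) : theta X *m y = <[v - u, y]> *: e1 - <[e1, y]> *: (v - u).
Proof. by have /(congr1 (mulmx^~ y)) := theta_X_wedge; rewrite /= wedgeE. Qed.

Let J2_col (y : V) : J2 *m y = <[v, y]> *: u - <[u, y]> *: v.
Proof. by have /(congr1 (mulmx^~ y)) := J2_wedge; rewrite /= wedgeE. Qed.

(** Apply the normalized bracket to [e0], which [J1] fixes and [J2] kills, and compare the multiples
    of [e0]. *)
Let e0e1 : <[e0, e1]> = 2.
Proof.
have := bracket e0.
rewrite J1e0 J2_col !(X_col, X'_col) !bformD !gram (bformC e1) => /colP H.
have : (2 * <[e0, e1]> - 4) *: e0 = 0.
  by apply/colP => i; have := H i; rewrite !linmxE => H'; lra.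
by move=> /eqP; rewrite scaler_eq0 (negPf e0_neq0) orbF => /eqP ?; lra.
Qed.

Lemma J1_wedge : J1 = 2^-1 *: wedge e0 e1.
Proof.
apply: eq_mulmx_col => y; have := bracket y.
rewrite J2_col !(X_col, X'_col) !bformD !gram (bformC e1 e0) e0e1.
move=> /colP H; apply/colP => i; have := H i.
rewrite -scalemxAl wedgeE !linmxE => H'.
by lra.
Qed.

Let w := locked (2^-1 *: (e0 + e1)).

Let ww : <[w, w]> = 1.
Proof. by rewrite /w -lock !bformD !gram (bformC e1) e0e1; lra. Qed.

Let vw : <[v, w]> = 0.
Proof. by rewrite /w -lock !bformD !gram; lra. Qed.

(** * The Cartan involution as conjugation by [k] *)

Definition so2_generator : M := 4^-1 *: (X - sigma X + theta X - sigma (theta X)).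

Local Notation q0 := so2_generator.

Lemma so2_generator_wedge : q0 = wedge w v.
Proof.
rewrite /so2_generator /w -lock !sigmaE // wedgeZl wedgeDl -/e0 -/e1.
by apply/matrixP => i j; rewrite !linmxE; field.
Qed.

Let gq0 : q0 \in g.
Proof. by apply/gP; rewrite so2_generator_wedge; exact: skew_wedge. Qed.

(** [theta] exchanges [X] with [theta X] and commutes with [sigma], so it only permutes the four
    terms. *)
Lemma theta_so2_generator : theta q0 = q0.
Proof.
rewrite /so2_generator linearZ /= !(linearD, linearN) /= thetaK //.
rewrite !theta_sigma // thetaK //.
by apply/matrixP => i j; rewrite !linmxE; ring.
Qed.

Let k : M := expm (pi *: q0).

Let q0_col (y : V) : q0 *m y = <[v, y]> *: w - <[w, y]> *: v.
Proof. by rewrite so2_generator_wedge wedgeE. Qed.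

Let gramw := (v_norm, ww, vw, bformC w v).

(** The generator is a rotation generator in the plane of [v] and [w]; at angle pi the rotation
    formula leaves [1 + 2 q0^2], which negates that plane. *)
Let k_col (y : V) : k *m y = y - (2 * <[v, y]>) *: v - (2 * <[w, y]>) *: w.
Proof.
have q3 : q0 * q0 * q0 = - q0.
  apply: eq_mulmx_col => x; rewrite -[_ * _ * _]/(_ *m _ *m _) -!mulmxA mulNmx.
  rewrite !q0_col !bformD !gramw.
  by apply/colP => i; rewrite !linmxE; ring.
rewrite /k expm_rotation // sinpi cospi scale0r addr0 mulmxDl mul1mx -scalemxAl.
rewrite -[q0 * q0]/(q0 *m q0) -mulmxA !q0_col !bformD !gramw.
by apply/colP => i; rewrite !linmxE; ring.
Qed.

Let kv : k *m v = - v.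
Proof.
rewrite k_col !gramw; apply/colP => i; rewrite !linmxE; ring.
Qed.

Let kk : k *m k = 1%:M.
Proof.
apply: eq_mulmx_col => x; rewrite -mulmxA mul1mx !k_col !bformD !gramw.
by apply/colP => i; rewrite !linmxE; ring.
Qed.

Let k_isometry x y : <[k *m x, k *m y]> = <[x, y]>.
Proof. by rewrite !k_col !bformD !gramw !(bformC x); ring. Qed.

Let conjk (Y : M) : M := k *m Y *m k.

Let skew_conjk Y : skew Y -> skew (conjk Y).
Proof.
move=> sY x y; rewrite /conjk -!mulmxA.
rewrite -[X in <[_, X]>]mul1mx -kk -mulmxA k_isometry sY.
by rewrite -k_isometry mulmxA kk mul1mx.
Qed.

(** The rotation formula at angle pi again, now for [ad q0]. It presents conjugation by [k] as a
    polynomial in [ad q0]. *)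
Let conjk_ad (Y : M) : skew Y -> conjk Y = Y + 2 *: ad q0 (ad q0 Y).
Proof.
move=> sY; apply: eq_mulmx_col => x.
rewrite mulmxDl -scalemxAl !adE_col /conjk -!mulmxA.
rewrite !k_col !q0_col !(mulmxBr, mulmxDr) -!scalemxAr.
rewrite !bformD !gramw !(skew0 _ sY) (_ : <[w, Y *m v]> = - <[v, Y *m w]>); last first.
  by rewrite -sY bformC.
by apply/colP => i; rewrite !linmxE; ring.
Qed.

(* The Gram matrix [- eta k] is positive definite: [k] is the reflection that negates
   the positive plane spanned by [v] and [w]. Its Cholesky factor turns the trace into
   minus a sum of squares. *)
Lemma mxtrace_conjk_le0 Y : skew Y -> \tr (Y *m conjk Y) <= 0.
Proof.
move=> sY; pose S : M := - (eta *m k).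
have kT : k^T *m eta = eta *m k.
  have /(congr1 (fun Z => Z *m k)) := bform_isometry k_isometry.
  by rewrite -mulmxA kk mulmx1.
have ST : S^T = S by rewrite /S linearN /= trmx_mul eta_tr kT.
have SP (x : V) : x != 0 -> 0 < (x^T *m S *m x) 0 0.
  move=> x0; rewrite /S mulmxN mulNmx mulmxA -mulmxA oppmxE -/(bform _ _).
  pose x' := x - <[v, x]> *: v - <[w, x]> *: w.
  have vx' : <[v, x']> = 0 by rewrite /x' !bformD !gramw; ring.
  have wx' : <[w, x']> = 0 by rewrite /x' !bformD !gramw; ring.
  have xE : <[x, x]> = <[x', x']> + <[v, x]> ^+ 2 + <[w, x]> ^+ 2.
    by rewrite /x' !bformD !gramw (bformC x v) (bformC x w); ring.
  have E : - <[x, k *m x]> = - <[x', x']> + <[v, x]> ^+ 2 + <[w, x]> ^+ 2.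
    have -> : <[x, k *m x]> = <[x, x]> - 2 * <[v, x]> ^+ 2 - 2 * <[w, x]> ^+ 2.
      by rewrite k_col !bformD (bformC x v) (bformC x w); ring.
    by rewrite xE; ring.
  rewrite E; have := sqr_ge0 <[v, x]>; have := sqr_ge0 <[w, x]>.
  have [x'0|x'0] := eqVneq x' 0.
    have xx : x = <[v, x]> *: v + <[w, x]> *: w.
      by rewrite -[LHS](subrK (<[v, x]> *: v)) -[X in X + _](subrK (<[w, x]> *: w))
        -/x' x'0 add0r addrC.
    move=> p1 p2; rewrite x'0 bform0l oppr0 add0r lt_neqAle addr_ge0 // andbT.
    apply: contra x0; rewrite eq_sym paddr_eq0 // !sqrf_eq0 => /andP[/eqP vx /eqP wx].
    by rewrite xx vx wx !scale0r addr0.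
  have := positive_plane_orthogonal l_ge3 v_norm ww vw vx' wx' x'0.
  by move=> ? ? ?; lra.
have [C SC] := cholesky ST SP.
have kE : k = - (eta *m S) by rewrite /S mulmxN opprK mulmxA eta_sqr mul1mx.
have YT : Y = - (eta *m Y^T *m eta) by rewrite skew_eta ?opprK.
have -> : \tr (Y *m conjk Y) = - \tr ((C *m Y *m eta *m C^T) *m (C *m Y *m eta *m C^T)^T).
  rewrite !trmx_mul eta_tr trmxK -!mulmxA (mulmxA C^T C) -SC.
  rewrite [in RHS]mxtrace_mulC -!mulmxA -SC /conjk -linearN /= -mulmxN.
  congr (\tr (_ *m _)).
  transitivity (- (k *m (eta *m Y^T *m eta) *m k)).
    by rewrite skew_eta // mulmxN mulNmx opprK.
  by rewrite /S !(mulmxN, mulNmx) opprK !mulmxA eta_sqr mul1mx.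
by rewrite oppr_le0 mxtrace_gram_ge0.
Qed.

(* Conjugation by [k] is [1 + 2 (ad q0)^2], hence commutes with [theta]; on
   [Z = Y - theta (k Y k)] the two involutions are opposite, so the Killing form would
   take both signs there unless [Z = 0]. *)
Lemma theta_conjk Y : Y \in g -> theta Y = k *m Y *m k.
Proof.
move=> gY; have sY := (gP Y).1 gY.
have conj_mem Z : Z \in g -> conjk Z \in g by move=> /gP sZ; apply/gP/skew_conjk.
have conjK Z : conjk (conjk Z) = Z.
  by rewrite /conjk !mulmxA kk mul1mx -mulmxA kk mulmx1.
have comm Z : Z \in g -> theta (conjk Z) = conjk (theta Z).
  move=> gZ; have sZ := (gP Z).1 gZ; have gtZ := theta_mem gZ.
  have gad W : W \in g -> ad q0 W \in g.
    by move=> /gP sW; apply/gP/skew_ad => //; apply/gP.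
  rewrite !conjk_ad //; last by apply/gP.
  by rewrite linearD linearZ /= !theta_ad ?gad // theta_so2_generator.
have : (Y - theta (conjk Y) == 0) || (Y - theta (conjk Y) != 0) by case: eqP.
set Z := _ - _; case/orP => [/eqP Z0|Z0].
  have : theta Y = theta (theta (conjk Y)) by congr (theta _);
      apply/eqP; rewrite -subr_eq0 -/Z Z0.
  by rewrite thetaK ?conj_mem.
have gZ : Z \in g by rewrite memvB // theta_mem ?conj_mem.
have tZ : theta Z = - conjk Z.
  rewrite /Z linearB /= thetaK ?conj_mem // comm // /conjk mulmxBr mulmxBl opprB.
  by rewrite -!/(conjk _) conjK.
case: theta_cartan => _ /(_ Z gZ Z0); rewrite tZ.
rewrite (killing_mxtrace gP) ?memvN ?conj_mem // mulmxN linearN /= => H.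
have := mxtrace_conjk_le0 ((gP Z).1 gZ).
have : (1 : R) <= l%:R - 1 by rewrite lerBrDl -[1 + 1]/(2%:R) ler_nat ltnW.
move=> H1 H2; move: H.
rewrite (_ : - _ = (l%:R - 1) * \tr (Z *m conjk Z)); last by ring.
by rewrite ltNge mulr_ge0_le0 // (le_trans ler01 H1).
Qed.

(** * The isotropic flags of [n] and of its image under [theta] *)

Hypothesis a_basis : basis_of a [:: J1; J2].
Let n := positive_part g J1 J2.
Let f := v + u.

Let J1_col (y : V) : J1 *m y = (2^-1 * <[e1, y]>) *: e0 - (2^-1 * <[e0, y]>) *: e1.
Proof.
have /(congr1 (mulmx^~ y)) := J1_wedge.
by rewrite /= -scalemxAl wedgeE scalerBr !scalerA.
Qed.

(** The weights of [J1] on vectors are 0, 1 and -1. Skewness makes an eigenvector of weight 2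
    orthogonal to [e0] and [e1], hence killed by [J1]. *)
Let J1_double (y : V) : J1 *m y = 2 *: y -> y = 0.
Proof.
move=> J1y; have /eqP : 2 *: y = 0.
  rewrite -J1y J1_col.
  have := kJ1 e0 y; have := kJ1 e1 y; rewrite J1y J1e0 J1e1 !bformD => H0 H1.
  have -> : <[e0, y]> = 0 by lra.
  have -> : <[e1, y]> = 0 by lra.
  by rewrite !mulr0 !scale0r subr0.
by rewrite scaler_eq0 pnatr_eq0 /= => /eqP.
Qed.

Let J2v : J2 *m v = u. Proof. by []. Qed.
Let J2u : J2 *m u = v.
Proof. by rewrite J2_col !gram scale0r scaleN1r sub0r opprK. Qed.

Let J2_double (y : V) : J2 *m y = 2 *: y -> y = 0.
Proof.
move=> J2y; have /eqP : 2 *: y = 0.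
  rewrite -J2y J2_col.
  have := kJ2 u y; have := kJ2 v y; rewrite J2y J2v J2u !bformD => H0 H1.
  have -> : <[v, y]> = 0 by lra.
  have -> : <[u, y]> = 0 by lra.
  by rewrite !scale0r subr0.
by rewrite scaler_eq0 pnatr_eq0 /= => /eqP.
Qed.

Let J1_fixed (y : V) : J1 *m y = y -> exists c, y = c *: e0.
Proof.
move=> J1y; exists (2^-1 * <[e1, y]>); rewrite -[LHS]J1y J1_col.
have := kJ1 e0 y; rewrite J1y J1e0 => H0.
have -> : <[e0, y]> = 0 by lra.
by rewrite mulr0 scale0r subr0.
Qed.

Let J12_fixed (y : V) : J1 *m y = y -> J2 *m y = y -> y = 0.
Proof.
move=> J1y J2y; rewrite -[LHS]J1y -[X in J1 *m X]J2y J2_col mulmxBr -!scalemxAr J1u J1v.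
by rewrite !scaler0 subr0.
Qed.

Let J2e0 : J2 *m e0 = 0.
Proof. by rewrite J2_col !gram !scale0r subr0. Qed.

Let J1f : J1 *m f = 0.
Proof. by rewrite mulmxDr J1v J1u addr0. Qed.

Let J2f : J2 *m f = f.
Proof. by rewrite mulmxDr J2u J2v addrC. Qed.

Let root_shift (J Y : M) al c (y : V) : ad J Y = al *: Y -> J *m y = c *: y ->
  J *m (Y *m y) = (al + c) *: (Y *m y).
Proof.
move=> adY Jy; have := adE_col J Y y; rewrite adY Jy -scalemxAl -scalemxAr.
by move=> /eqP; rewrite eq_sym subr_eq -scalerDl => /eqP.
Qed.

(** The vectors [e0] and [f] have joint weights (1, 0) and (0, 1), and [Y] adds (al, be) to them. A
    weight with a coordinate 2 and the weight (1, 1) do not occur, and first weight 1 occurs only on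
    the line of [e0]. *)
Let root_flag al be Y : (al, be) \in [:: (1, 1); (1, -1); (1, 0); (0, 1)] ->
  Y \in root_space g J1 J2 al be -> Y *m e0 = 0 /\ exists c, Y *m f = c *: e0.
Proof.
move=> ab /mem_root_space[gY ad1 ad2].
have e1' : J1 *m (Y *m e0) = (al + 1) *: (Y *m e0).
  by apply: root_shift; rewrite ?J1e0 ?scale1r.
have e2' : J2 *m (Y *m e0) = (be + 0) *: (Y *m e0).
  by apply: root_shift; rewrite ?J2e0 ?scale0r.
have f1 : J1 *m (Y *m f) = (al + 0) *: (Y *m f).
  by apply: root_shift; rewrite ?J1f ?scale0r.
have f2 : J2 *m (Y *m f) = (be + 1) *: (Y *m f).
  by apply: root_shift; rewrite ?J2f ?scale1r.
have Yf0 : Y *m f = 0 -> exists c, Y *m f = c *: e0.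
  by move=> ->; exists 0; rewrite scale0r.
move: ab e1' e2' f1 f2; rewrite !inE => /or4P[] /eqP[-> ->] h1 h2 h3 h4.
- by split; [exact: J1_double | apply: Yf0; exact: J2_double].
- by split; [exact: J1_double | apply: J1_fixed; rewrite h3 addr0 scale1r].
- by split; [exact: J1_double | apply: J1_fixed; rewrite h3 addr0 scale1r].
- split; last by apply: Yf0; exact: J2_double.
  by apply: J12_fixed; rewrite ?h1 ?h2 ?add0r ?addr0 scale1r.
Qed.

Let n_root al be Y : (al, be) \in [:: (1, 1); (1, -1); (1, 0); (0, 1)] ->
  Y \in root_space g J1 J2 al be -> Y \in n.
Proof.
rewrite /n /positive_part !inE => /or4P[] /eqP[-> ->] rY.
- by rewrite -[Y]addr0 memv_add ?mem0v // -[Y]addr0 memv_add ?mem0v //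
    -[Y]addr0 memv_add ?mem0v.
- by rewrite -[Y]addr0 memv_add ?mem0v // -[Y]addr0 memv_add ?mem0v //
    -[Y]add0r memv_add ?mem0v.
- by rewrite -[Y]addr0 memv_add ?mem0v // -[Y]add0r memv_add ?mem0v.
- by rewrite -[Y]add0r memv_add ?mem0v.
Qed.

Let wedge_root a1 a2 b1 b2 (b c : V) : J1 *m b = a1 *: b -> J2 *m b = a2 *: b ->
  J1 *m c = b1 *: c -> J2 *m c = b2 *: c ->
  wedge b c \in root_space g J1 J2 (a1 + b1) (a2 + b2).
Proof.
move=> J1b J2b J1c J2c; apply/mem_root_space; split.
- by apply/gP; exact: skew_wedge.
- by rewrite ad_wedge // J1b J1c wedgeZl wedgeZr scalerDl.
- by rewrite ad_wedge // J2b J2c wedgeZl wedgeZr scalerDl.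
Qed.

Lemma flag_data_n : flag_data v e0 f a n.
Proof.
have fE y : <[f, y]> = <[v, y]> + <[u, y]> by rewrite bformDl.
have fE' y : <[y, f]> = <[v, y]> + <[u, y]> by rewrite bformC fE.
(* For [z] orthogonal to [e0], [res z] is its component of joint weight 0, orthogonal to [e0], [e1],
   [v] and [u]. The sign of the last term comes from [<[u, u]> = -1]. *)
pose res (z : V) := z - (2^-1 * <[e1, z]>) *: e0 - <[v, z]> *: v + <[u, z]> *: u.
have J1res z : <[e0, z]> = 0 -> J1 *m res z = 0 *: res z.
  move=> e0z; rewrite J1_col scale0r /res !bformD !gram e0z (bformC e1 e0) e0e1.
  by apply/colP => i; rewrite !linmxE; field.
have J2res z : J2 *m res z = 0 *: res z.
  rewrite J2_col scale0r /res !bformD !gram.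
  by apply/colP => i; rewrite !linmxE; ring.
have J1f' : J1 *m f = 0 *: f by rewrite J1f scale0r.
have J2f' : J2 *m f = 1 *: f by rewrite J2f scale1r.
have J1e0' : J1 *m e0 = 1 *: e0 by rewrite J1e0 scale1r.
have J2e0' : J2 *m e0 = 0 *: e0 by rewrite J2e0 scale0r.
have aE X0 : X0 \in a -> exists s t, X0 = s *: J1 + t *: J2.
  have /andP[/eqP <- _] := a_basis; rewrite span_cons span_seq1.
  by case/memv_addP => _ /vlineP[s ->] [_ /vlineP[t ->] ->]; exists s, t.
have J1a : J1 \in a by apply: (basis_mem a_basis); rewrite !inE eqxx.
have J2a : J2 \in a by apply: (basis_mem a_basis); rewrite !inE eqxx orbT.
split.
- exact: e0e0.
- by rewrite fE !fE' !gram; ring.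
- by rewrite fE' !gram addr0.
- exact: e0v.
- by rewrite fE !gram addr0 oner_eq0.
- exact: e0_neq0.
- move=> Y /aE[s [t ->]]; exists s, t; rewrite !mulmxDl -!scalemxAl.
  by rewrite J1e0 J2e0 J1f J2f !scaler0 addr0 add0r.
- by move=> s; exists (s *: J1); rewrite ?memvZ // -scalemxAl J1e0.
- by move=> t; exists (t *: J2); rewrite ?memvZ // -scalemxAl J2f.
- move=> Y /memv_addP[Y1 /memv_addP[Y2 /memv_addP[Y3 r3 [Y4 r4 ->]] [Y5 r5 ->]] [Y6 r6 ->]].
  have [] := root_flag _ r3; first by rewrite !inE eqxx.
  have [] := root_flag _ r4; first by rewrite !inE eqxx !orbT.
  have [] := root_flag _ r5; first by rewrite !inE eqxx !orbT.
  have [] := root_flag _ r6; first by rewrite !inE eqxx !orbT.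
  move=> h6 [c6 f6] h5 [c5 f5] h4 [c4 f4] h3 [c3 f3].
  rewrite !mulmxDl h3 h4 h5 h6 !addr0; split=> //.
  by exists (c3 + c4 + c5 + c6); rewrite f3 f4 f5 f6 !scalerDl.
- move=> z e0z.
  (* Split [z] into weight vectors: the terms have roots (1, 0), (1, 1) and (1, -1), and the
     component along [e0] disappears in the wedge. *)
  have -> : wedge e0 z = wedge e0 (res z) +
      (2^-1 * (<[v, z]> - <[u, z]>)) *: wedge e0 f +
      (2^-1 * (<[v, z]> + <[u, z]>)) *: wedge e0 (v - u).
    apply: eq_mulmx_col => x; rewrite !mulmxDl -!scalemxAl !wedgeE /res /f.
    rewrite !bformD; apply/colP => i; rewrite !linmxE; by field.
  have m1 : wedge e0 (res z) \in n.
    by apply: n_root (wedge_root J1e0' J2e0' (J1res _ e0z) (J2res z));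
      rewrite !inE !addr0 eqxx !orbT.
  have m2 : wedge e0 f \in n.
    by apply: n_root (wedge_root J1e0' J2e0' J1f' J2f'); rewrite !inE addr0 add0r eqxx.
  have m3 : wedge e0 (v - u) \in n.
    have J1f2 : J1 *m (v - u) = 0 *: (v - u).
      by rewrite scale0r mulmxDr mulmxN J1v J1u subr0.
    have J2f2 : J2 *m (v - u) = -1 *: (v - u).
      by rewrite scaleN1r mulmxDr mulmxN J2v J2u opprB.
    by apply: n_root (wedge_root J1e0' J2e0' J1f2 J2f2); rewrite !inE addr0 add0r eqxx !orbT.
  by rewrite !memvD // memvZ.
- move=> z e0z fz.
  have uz : <[u, z]> = - <[v, z]> by move: fz; rewrite fE => ?; lra.
  (* Being orthogonal to [f], [z] has its part in the plane of [v] and [u] along [f] itself, which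
     the wedge kills. The roots left are (0, 1) and (1, 1). *)
  have -> : wedge f z = wedge f (res z) + (- 2^-1 * <[e1, z]>) *: wedge e0 f.
    apply: eq_mulmx_col => x; rewrite !mulmxDl -!scalemxAl !wedgeE /res /f.
    rewrite !bformD uz; apply/colP => i; rewrite !linmxE; by field.
  rewrite memvD // ?memvZ //.
    by apply: n_root (wedge_root J1f' J2f' (J1res _ e0z) (J2res z));
      rewrite !inE !addr0 eqxx !orbT.
  by apply: n_root (wedge_root J1e0' J2e0' J1f' J2f'); rewrite !inE addr0 add0r eqxx.
Qed.

Let theta_mem_n Y : Y \in n -> Y \in g.
Proof.
move=> /memv_addP[Y1 /memv_addP[Y2 /memv_addP[Y3 r3 [Y4 r4 ->]] [Y5 r5 ->]] [Y6 r6 ->]].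
by rewrite !memvD //; [move: r3|move: r4|move: r5|move: r6] => /mem_root_space[].
Qed.

(** Conjugation by the isometry [k] carries the flag of [n] to that of its image. It acts as -1 on
    [a], so the eigenvalues on the flag change sign, and [k *m v = - v] only changes the signs of
    the pairings with [v]. *)
Lemma flag_data_nbar : flag_data v (k *m e0) (k *m f) a (theta @: n)%VS.
Proof.
have [ee ff ef ev fv e_n0 fa fae faf fn fne fnf] := flag_data_n.
have kE (y : V) : k *m (k *m y) = y by rewrite mulmxA kk mul1mx.
have isoC x y : <[k *m x, y]> = <[x, k *m y]> by rewrite -[y in LHS]kE k_isometry.
have thetaa Y : Y \in a -> Y \in g /\ theta Y = - Y.
  have /andP[/eqP <- _] := a_basis; rewrite span_cons span_seq1.
  case/memv_addP => _ /vlineP[s ->] [_ /vlineP[t ->] ->].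
  rewrite memvD ?memvZ //; split=> //.
  by rewrite linearD !linearZ /= theta_J1 theta_J2 !scalerN opprD.
have aK (Y : M) (y : V) : Y \in a -> Y *m (k *m y) = - (k *m (Y *m y)).
  move=> /thetaa[gY tY]; have := theta_conjk gY; rewrite tY => YE.
  by rewrite -[Y in LHS]opprK YE mulNmx -!mulmxA kE.
have wedgek (b c : V) : theta (wedge b (k *m c)) = wedge (k *m b) c.
  rewrite theta_conjk; last by apply/gP; exact: skew_wedge.
  apply: eq_mulmx_col => x; rewrite -!mulmxA wedgeE mulmxBr -!scalemxAr !wedgeE.
  by rewrite k_isometry -isoC kE.
split.
- by rewrite k_isometry.
- by rewrite k_isometry.
- by rewrite k_isometry.
- by rewrite isoC kv bformNr ev oppr0.
- by rewrite isoC kv bformNr oppr_eq0.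
- by apply: contra e_n0 => /eqP E; rewrite -[e0]kE E mulmx0.
- move=> Y aY; have [s [t [Ye Yf]]] := fa Y aY; exists (- s), (- t).
  by rewrite !aK // Ye Yf -!scalemxAr !scaleNr.
- by move=> s; have [Y aY Ye] := fae (- s); exists Y => //;
    rewrite aK // Ye -scalemxAr scaleNr opprK.
- by move=> s; have [Y aY Ye] := faf (- s); exists Y => //;
    rewrite aK // Ye -scalemxAr scaleNr opprK.
- move=> _ /memv_imgP[Y nY ->]; have [Ye [c Yf]] := fn Y nY.
  rewrite (theta_conjk (theta_mem_n nY)) -!mulmxA !kE Ye Yf mulmx0; split=> //.
  by exists c; rewrite -scalemxAr.
- by move=> z; rewrite isoC => ez; rewrite -wedgek memv_img // fne.
- move=> z; rewrite !isoC => ez fz.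
  by rewrite -wedgek memv_img // fnf.
Qed.

Lemma cartan_structure :
  [/\ [/\ q0 \in g, theta q0 = q0, k *m v = - v &
          forall Y, Y \in g -> theta Y = k * Y * k^-1],
      flag_data v e0 f a n /\ (n <= g)%VS &
      flag_data v (k *m e0) (k *m f) a (theta @: n)%VS /\ (theta @: n <= g)%VS].
Proof.
have ng : (n <= g)%VS by apply/subvP => Y; exact: theta_mem_n.
have kU : k \is a GRing.unit by apply/unitrP; exists k; split; exact: kk.
have kV : k^-1 = k by apply: (mulrI kU); rewrite divrr // -[k * k]/(k *m k) kk.
split; first split.
- exact: gq0.
- exact: theta_so2_generator.
- exact: kv.
- by move=> Y gY; rewrite kV; exact: theta_conjk.
- by split=> //; exact: flag_data_n.
split; first exact: flag_data_nbar.
by apply/subvP => _ /memv_imgP[Y nY ->]; exact: theta_mem (subvP ng _ nY).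
Qed.

End Structure.

(** * Orbits *)

Section FlagOrbits.
Variables (R : realType) (l : nat).
Local Notation M := 'M[R]_l.+1.
Local Notation V := 'cV[R]_l.+1.
Local Notation "<[ x , y ]>" := (bform x y) (at level 0, x, y at level 99).
Local Notation G := (set_type (SO0 R l)).
Variables (v e f : V) (g a n : {vspace M}) (k : M).
Hypotheses (l_ge3 : (3 <= l)%N) (v_norm : <[v, v]> = 1).
Hypotheses (g_lie : lie_algebra_of (SO0 R l) g).
Hypotheses (a_sub : (a <= g)%VS) (n_sub : (n <= g)%VS).
Hypothesis fl : flag_data v e f a n.
Hypotheses (Gk : SO0 R l k) (kv : k *m v = - v).
Let AN : set M := prod_set (connected_subgroup a) (connected_subgroup n).

Let SO0_bform (r : M) x y : SO0 R l r -> <[r *m x, r *m y]> = <[x, y]>.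
Proof. by move=> /SO0_sub; exact: SO_full_bform. Qed.

Let SO0_unit (r : M) : SO0 R l r -> r \is a GRing.unit.
Proof. by have [_ H _ _] := SO0_subgroup R l; exact: H. Qed.

Let unitK (r : M) (y : V) : r \is a GRing.unit -> r^-1 *m (r *m y) = y.
Proof. by move=> ur; rewrite mulmxA -[r^-1 *m r]/(r^-1 * r) mulVr ?mul1mx. Qed.

Let unitVK (r : M) (y : V) : r \is a GRing.unit -> r *m (r^-1 *m y) = y.
Proof. by move=> ur; rewrite mulmxA -[r *m r^-1]/(r * r^-1) divrr ?mul1mx. Qed.

Lemma AdS_pi_eq (x y : G) :
  \pi_(AdS v)%qT x = \pi_(AdS v)%qT y <-> val x *m v = val y *m v.
Proof.
have Gx := set_mem (valP x); have Gy := set_mem (valP y).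
have [_ U SM SV] := SO0_subgroup R l.
split=> [/eqmodP/asboolP[_ H]|H].
  by rewrite -[in LHS]H -mulmxA unitVK //; exact: U.
apply/eqmodP/asboolP; split; first by apply: SM => //; exact: SV.
by rewrite -[_ * _]/(_ *m _) -mulmxA -H unitK //; exact: U.
Qed.

Lemma AdS_piP (p : AdS v) : exists x : G, p = \pi_(AdS v)%qT x.
Proof. by exists (repr p); rewrite reprK. Qed.

Lemma AdS_orbit_pi (S : set M) (x y : G) :
  AdS_orbit v S (\pi_(AdS v)%qT x) (\pi_(AdS v)%qT y) <->
  exists r, [/\ S r, SO0 R l r & val y *m v = r *m (val x *m v)].
Proof.
split=> [[r Sr [x' /= /AdS_pi_eq x'x /AdS_pi_eq E]]|[r [Sr Gr E]]].
  exists (val r); split=> //; first exact: set_mem (valP r).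
  by rewrite -E -x'x mulmxA.
exists (Sub r (mem_set Gr)); first exact: Sr.
exists x => //=; apply/AdS_pi_eq; rewrite /= E mulmxA.
by [].
Qed.

Lemma AdS_proj_pi (S : set M) (y : G) :
  AdS_proj v S (\pi_(AdS v)%qT y) <->
  exists r, [/\ S r, SO0 R l r & val y *m v = r *m v].
Proof.
split=> [[r Sr /AdS_pi_eq E]|[r [Sr Gr E]]].
  by exists (val r); split=> //; exact: set_mem (valP r).
exists (Sub r (mem_set Gr)); first exact: Sr.
by apply/AdS_pi_eq.
Qed.

(** The positivity of [s] and [t] is what makes the signs attached to the flag invariant. *)
Let flag_stab (r : M) := SO0 R l r /\
  exists s t c, [/\ 0 < s, 0 < t, r *m e = s *: e & r *m f = t *: f + c *: e].

Let flag_stab_subgroup : is_subgroup flag_stab.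
Proof.
have [S1 SU SM SV] := SO0_subgroup R l.
split.
- split=> //; exists 1, 1, 0; split; rewrite ?ltr01 //.
    by rewrite mul1mx scale1r.
  by rewrite mul1mx scale1r scale0r addr0.
- by move=> x [/SU].
- move=> x y [Gx [s [t [c [s0 t0 xe xf]]]]] [Gy [s' [t' [c' [s'0 t'0 ye yf]]]]].
  split; first exact: SM.
  exists (s' * s), (t' * t), (t' * c + c' * s); split; rewrite ?mulr_gt0 //.
    by rewrite -[x * y]/(x *m y) -mulmxA ye -scalemxAr xe scalerA.
  rewrite -[x * y]/(x *m y) -mulmxA yf mulmxDr -!scalemxAr xe xf.
  by apply/colP => i; rewrite !linmxE; ring.
- move=> x [Gx [s [t [c [s0 t0 xe xf]]]]]; split; first exact: SV.
  have xK (y : V) : x^-1 *m (x *m y) = y by rewrite unitK //; exact: SU.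
  have xe' : x^-1 *m e = s^-1 *: e.
    by rewrite -[e in LHS](scalerK (lt0r_neq0 s0)) -xe -scalemxAr xK.
  exists s^-1, t^-1, (- (t^-1 * c / s)); split; rewrite ?invr_gt0 //.
  have -> : f = t^-1 *: (x *m f - c *: e).
    by rewrite xf addrK scalerK // lt0r_neq0.
  rewrite -scalemxAr mulmxDr xK mulmxN -scalemxAr xe' xf addrK.
  by apply/colP => i; rewrite !linmxE; field; rewrite !lt0r_neq0.
Qed.

Let SO0_expm (X : M) : X \in g -> SO0 R l (expm X).
Proof. by move=> /g_lie/(_ 1); rewrite scale1r. Qed.

(** A connected subgroup lies in every subgroup that contains the exponentials of its Lie algebra,
    so it suffices to exponentiate: elements of [a] give positive eigenvalues, elements of [n]
    unipotent maps of the flag. *)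
Let AN_flag_stab r : AN r -> flag_stab r.
Proof.
have [_ _ SM _] := flag_stab_subgroup.
move=> [x Ax [y Ny <-]]; apply: SM.
  apply: Ax => // X aX; split; first by apply: SO0_expm; exact: (subvP a_sub).
  have [s [t [Xe Xf]]] := flag_a fl aX.
  exists (expR s), (expR t), 0; split; rewrite ?expR_gt0 //.
    exact: expm_eigen.
  by rewrite scale0r addr0; exact: expm_eigen.
apply: Ny => // X nX; split; first by apply: SO0_expm; exact: (subvP n_sub).
have [Xe [c Xf]] := flag_n fl nX.
have XXf : X *m (X *m f) = 0 by rewrite Xf -scalemxAr Xe scaler0.
exists 1, 1, c; rewrite !scale1r; split; rewrite ?ltr01 //.
  by rewrite expm_nilpotent Xe ?mulmx0 // scaler0 !addr0.
by rewrite expm_nilpotent XXf ?mulmx0 // scaler0 addr0 Xf.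
Qed.

Let AN_SO0 r : AN r -> SO0 R l r. Proof. by case/AN_flag_stab. Qed.

(* The quadratic term of the exponential only moves the point along [b], by the amount
   that equality of norms dictates. *)
Lemma expm_null_wedge (b x y : V) : <[b, b]> = 0 -> <[b, x]> = <[b, y]> ->
    <[b, x]> != 0 -> <[x, x]> = <[y, y]> ->
  expm (wedge b (<[b, x]>^-1 *: (x - y))) *m x = y.
Proof.
move=> bb bxy; set c := <[b, x]> => c0 xy.
rewrite expm_nilpotent !wedgeE !bformD -?/c bb -?bxy -?/c !(bformC _ b) -?/c -?bxy -?/c.
  rewrite (bformC y x) -xy.
  by apply/colP => i; rewrite !linmxE; field.
by apply/colP => i; rewrite !linmxE; ring.
Qed.

Let mem_connected (s : {vspace M}) X : X \in s -> connected_subgroup s (expm X).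
Proof. by move=> sX S _; apply. Qed.

(** First an element of [exp a] rescales [b] so that [x] and the pulled back target [y'] pair
    equally with [b]; then a unipotent element of [N] moves [x] to [y']. It serves with [b = e] and
    with [b = f]; the clause on [e] is for the second case. *)
Let AN_move (b : V) X x y : X \in a -> X *m b = ln (<[b, x]> / <[b, y]>) *: b ->
  <[b, b]> = 0 -> 0 < <[b, x]> * <[b, y]> -> <[x, x]> = 1 -> <[y, y]> = 1 ->
  (forall z, <[b, z]> = 0 -> (<[e, x]> = 0 -> <[e, y]> = 0 -> <[e, z]> = 0) ->
     wedge b z \in n) ->
  exists r, [/\ AN r, SO0 R l r & y = r *m x].
Proof.
move=> aX Xb bb bxy xx yy bn.
have bx0 : <[b, x]> != 0 by apply: contraTneq bxy => ->; rewrite mul0r ltxx.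
have by0 : <[b, y]> != 0 by apply: contraTneq bxy => ->; rewrite mulr0 ltxx.
have q0 : 0 < <[b, x]> / <[b, y]>.
  have -> : <[b, x]> / <[b, y]> = <[b, x]> * <[b, y]> / <[b, y]> ^+ 2 by field.
  by rewrite divr_gt0 // exprn_even_gt0.
have [Ae [s [t [c [s0 t0 Aee Aef]]]]] : flag_stab (expm X).
  split; first by apply: SO0_expm; exact: (subvP a_sub).
  have [s [t [Xe Xf]]] := flag_a fl aX.
  exists (expR s), (expR t), 0; split; rewrite ?expR_gt0 //.
    exact: expm_eigen.
  by rewrite scale0r addr0; exact: expm_eigen.
set A := expm X in Ae Aee Aef.
have Ab : A *m b = (<[b, x]> / <[b, y]>) *: b.
  by rewrite /A (expm_eigen Xb) lnK.
pose y' := A^-1 *m y.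
have Ay' : A *m y' = y.
  by rewrite /y' unitVK //; exact: SO0_unit.
have by' : <[b, x]> = <[b, y']>.
  by rewrite -(SO0_bform b y' Ae) Ay' Ab bformZl divfK.
have yy' : <[x, x]> = <[y', y']> by rewrite -(SO0_bform y' y' Ae) Ay' xx yy.
pose W := wedge b (<[b, x]>^-1 *: (x - y')).
have nW : W \in n.
  apply: bn; first by rewrite !bformD -by' subrr mulr0.
  (* Since [exp X] scales [e], orthogonality to [e] passes from [y] to [y']. *)
  move=> ex ey; rewrite !bformD ex sub0r.
  have := SO0_bform e y' Ae; rewrite Ay' Aee bformZl ey mulr0 => <-.
  by rewrite oppr0 mulr0.
have ANr : AN (A * expm W).
  by exists A; [exact: mem_connected | exists (expm W) => //; exact: mem_connected].
exists (A * expm W); split=> //; first exact: AN_SO0.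
have WE : expm W *m x = y' := expm_null_wedge bb by' bx0 yy'.
by rewrite -[A * expm W]/(A *m expm W) -mulmxA WE Ay'.
Qed.

Lemma AN_orbitP (x y : V) : <[x, x]> = 1 -> <[y, y]> = 1 ->
  (exists r, [/\ AN r, SO0 R l r & y = r *m x]) <->
  (0 < <[e, x]> * <[e, y]> \/
   [/\ <[e, x]> = 0, <[e, y]> = 0 & 0 < <[f, x]> * <[f, y]>]).
Proof.
move=> xx yy; split.
  move=> [r [/AN_flag_stab[Gr [s [t [c [s0 t0 re rf]]]]] _ yE]].
  have ex : <[e, x]> = s * <[e, y]> by rewrite -(SO0_bform e x Gr) -yE re bformZl.
  have fx : <[f, x]> = t * <[f, y]> + c * <[e, y]>.
    by rewrite -(SO0_bform f x Gr) -yE rf !bformD.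
  have [ey|ey] := eqVneq <[e, y]> 0; last first.
    by left; rewrite ex -mulrA mulr_gt0 // -expr2 exprn_even_gt0.
  right; rewrite ex ey mulr0; split=> //; rewrite fx ey mulr0 addr0 -mulrA.
  rewrite mulr_gt0 // -expr2 exprn_even_gt0 //=.
  exact: (isotropic_plane_maximal l_ge3 (flag_ee fl) (flag_ff fl) (flag_ef fl)
    (flag_ev fl) (flag_fv fl) (flag_e_neq0 fl)).
move=> [exy|[ex ey fxy]].
  have [X aX Xe] := flag_ae fl (ln (<[e, x]> / <[e, y]>)).
  by apply: (AN_move aX Xe) => //; [exact: flag_ee fl | move=> z ez _; exact: (flag_ne fl ez)].
have [X aX Xf] := flag_af fl (ln (<[f, x]> / <[f, y]>)).
apply: (AN_move aX Xf) => //; first exact: flag_ff fl.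
by move=> z fz ez; exact: (flag_nf fl (ez ex ey) fz).
Qed.

Let Gvv (x : G) : <[val x *m v, val x *m v]> = 1.
Proof. by rewrite SO0_bform //; exact: set_mem (valP x). Qed.

Let orbitP (x y : G) : AdS_orbit v AN (\pi_(AdS v)%qT x) (\pi_(AdS v)%qT y) <->
  (0 < <[e, val x *m v]> * <[e, val y *m v]> \/
   [/\ <[e, val x *m v]> = 0, <[e, val y *m v]> = 0 &
       0 < <[f, val x *m v]> * <[f, val y *m v]>]).
Proof. by rewrite AdS_orbit_pi; exact: AN_orbitP. Qed.

Let proj_plusP (y : G) : AdS_proj v AN (\pi_(AdS v)%qT y) <->
  <[e, val y *m v]> = 0 /\ 0 < <[f, v]> * <[f, val y *m v]>.
Proof.
rewrite AdS_proj_pi AN_orbitP // (flag_ev fl) mul0r ltxx.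
by split=> [[//|[_ ? ?]]|[? ?]]; [split | right].
Qed.

Let proj_minusP (y : G) : AdS_proj v (rtranslate AN k) (\pi_(AdS v)%qT y) <->
  <[e, val y *m v]> = 0 /\ <[f, v]> * <[f, val y *m v]> < 0.
Proof.
have [_ _ SM _] := SO0_subgroup R l.
have nvnv : <[- v, - v]> = 1 by rewrite !bformD opprK.
rewrite AdS_proj_pi; transitivity (exists r, [/\ AN r, SO0 R l r & val y *m v = r *m (- v)]).
  split=> [[_ [[r ANr <-] _ E]]|[r [ANr Gr E]]].
    by exists r; split=> //; [exact: AN_SO0 | rewrite E -mulmxA kv].
  exists (r * k); split; [by exists r | exact: SM | ].
  by rewrite E -[r * k]/(r *m k) -mulmxA kv.
rewrite AN_orbitP // !bformNr (flag_ev fl) oppr0 mul0r ltxx mulNr oppr_gt0.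
by split=> [[//|[_ ? ?]]|[? ?]]; [split | right].
Qed.

(** * Open and closed orbits *)

Lemma continuous_bform_mulmx (b x : V) : continuous (fun Y : M => <[b, Y *m x]>).
Proof.
rewrite (_ : (fun Y : M => _) =
    fun Y => \sum_i \sum_j (sgn R i * b i 0 * x j 0) * Y i j).
  apply: continuous_big => [|i _]; first exact: add_continuous.
  apply: continuous_big => [|j _]; first exact: add_continuous.
  by move=> Y; apply: cvgMl_tmp; [exact: (@nbhs_filter M Y) | exact: coord_continuous].
apply/funext => Y; rewrite bformE; apply: eq_bigr => i _.
rewrite mxE mulrA mulr_sumr; apply: eq_bigr => j _; ring.
Qed.

(** A set in the quotient is open when its preimage in [SO0] is the trace of an open set of
    matrices. *)
Let open_AdS (O : set (AdS v)) (W : set M) : open W ->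
  (forall y : G, O (\pi_(AdS v)%qT y) <-> W (val y)) -> open O.
Proof.
move=> oW H; exists W => //; apply/seteqP; split=> y /= /H //.
Qed.

Let closed_AdS (O : set (AdS v)) (W : set M) : closed W ->
  (forall y : G, O (\pi_(AdS v)%qT y) <-> W (val y)) -> closed O.
Proof.
move=> cW H; rewrite -openC; apply: (@open_AdS _ (~` W)); first by rewrite openC.
by move=> y; split=> + /H.
Qed.

(** The weak inequality makes the region closed. On the hyperboloid it agrees with the strict one
    that describes an orbit, because [f] and [e] cannot both be orthogonal to a point. *)
Let closed_region c : closed [set Y : M | <[e, Y *m v]> = 0 /\ 0 <= c * <[f, Y *m v]>].
Proof.
apply: closedI.
  apply: (@closed_comp _ _ (fun Y : M => <[e, Y *m v]>) [set 0]).
    by move=> Y _; exact: continuous_bform_mulmx.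
  exact: closed_eq.
apply: (@closed_comp _ _ (fun Y : M => c * <[f, Y *m v]>) [set t | 0 <= t]).
  by move=> Y _; apply: cvgMl_tmp; [exact: (@nbhs_filter M Y) | exact: continuous_bform_mulmx].
exact: closed_ge.
Qed.

Let open_region c : open [set Y : M | 0 < c * <[e, Y *m v]>].
Proof.
apply: (@open_comp _ _ (fun Y : M => c * <[e, Y *m v]>) [set t | 0 < t]).
  by move=> Y _; apply: cvgMl_tmp; [exact: (@nbhs_filter M Y) | exact: continuous_bform_mulmx].
exact: open_gt.
Qed.

Let f_neq0 (y : G) : <[e, val y *m v]> = 0 -> <[f, val y *m v]> != 0.
Proof.
exact: (isotropic_plane_maximal l_ge3 (flag_ee fl) (flag_ff fl) (flag_ef fl)
    (flag_ev fl) (flag_fv fl) (flag_e_neq0 fl) (Gvv y)).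
Qed.

Let AdS_ext (O O' : set (AdS v)) :
  (forall y : G, O (\pi_(AdS v)%qT y) <-> O' (\pi_(AdS v)%qT y)) -> O = O'.
Proof.
move=> H; apply/seteqP; split=> p; have [y ->] := AdS_piP p; exact: (H y).1 || exact: (H y).2.
Qed.

(* A closed orbit of this kind would lift to a clopen subset of the connected group
   [SO0] that misses [1], since [v] is orthogonal to [e]. *)
Let orbit_open_not_closed (x : G) : <[e, val x *m v]> != 0 ->
  open (AdS_orbit v AN (\pi_(AdS v)%qT x)) /\
  ~ closed (AdS_orbit v AN (\pi_(AdS v)%qT x)).
Proof.
set c := <[e, _]> => c0.
have OE (y : G) : AdS_orbit v AN (\pi_(AdS v)%qT x) (\pi_(AdS v)%qT y) <->
    0 < c * <[e, val y *m v]>.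
  rewrite orbitP -/c; split=> [[//|[c00]]|]; last by left.
  by rewrite c00 eqxx in c0.
split; first by apply: (open_AdS (@open_region c)) => y; exact: OE.
rewrite -openC => -[W oW WE].
have connG : connected (SO0 R l) by exact: component_connected.
have [S1 _ _ _] := SO0_subgroup R l.
pose B := SO0 R l `&` [set Y : M | 0 < c * <[e, Y *m v]>].
have BE : B = SO0 R l.
  apply: connG.
  - exists (val x); split; first exact: set_mem (valP x).
    by rewrite /= -/c -expr2 exprn_even_gt0.
  - by exists [set Y : M | 0 < c * <[e, Y *m v]>]; first exact: open_region.
  - exists (~` W); first by rewrite closedC.
    apply/seteqP; split=> Y [GY HY]; split=> //.
      pose y : G := Sub Y (mem_set GY).
      move=> WY; have : (val @^-1` W) y by exact: WY.
      by rewrite WE => /= /OE; exact.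
    pose y : G := Sub Y (mem_set GY).
    apply/not_notP => nHY; apply: HY.
    have Wy : (val @^-1` W) y by rewrite WE /= => /OE.
    exact: Wy.
have : B 1 by rewrite BE.
by case=> _ /=; rewrite mul1mx (flag_ev fl) mulr0 ltxx.
Qed.

Let proj_plus_closed : closed (AdS_proj v AN).
Proof.
apply: (closed_AdS (@closed_region <[f, v]>)) => y; rewrite proj_plusP /=.
split=> [[? /ltW]//|[e0 fy]]; split=> //.
by rewrite lt_neqAle fy andbT eq_sym mulf_neq0 ?(flag_fv fl) ?f_neq0.
Qed.

Let proj_minus_closed : closed (AdS_proj v (rtranslate AN k)).
Proof.
apply: (closed_AdS (@closed_region (- <[f, v]>))) => y; rewrite proj_minusP /=.
rewrite mulNr oppr_ge0.
split=> [[? /ltW]//|[e0 fy]]; split=> //.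
by rewrite lt_neqAle fy andbT mulf_neq0 ?(flag_fv fl) ?f_neq0.
Qed.

Let one : G := Sub 1 (mem_set (let: And4 S1 _ _ _ := SO0_subgroup R l in S1)).
Let kG : G := Sub k (mem_set Gk).

Let proj_plus_orbit : AdS_proj v AN = AdS_orbit v AN (\pi_(AdS v)%qT one).
Proof.
apply: AdS_ext => y; rewrite proj_plusP orbitP /= mul1mx (flag_ev fl) mul0r ltxx.
by split=> [[? ?]|[//|[_ ? ?]]]; [right | split].
Qed.

Let proj_minus_orbit :
  AdS_proj v (rtranslate AN k) = AdS_orbit v AN (\pi_(AdS v)%qT kG).
Proof.
apply: AdS_ext => y; rewrite proj_minusP orbitP /= kv !bformNr (flag_ev fl).
rewrite oppr0 mul0r ltxx mulNr oppr_gt0.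
by split=> [[? ?]|[//|[_ ? ?]]]; [right | split].
Qed.

(** The pairing with [f] is nonzero here, and its sign relative to [<[f, v]>] decides between the
    orbits of the base point and of its antipode. *)
Let orbit_cases (x : G) : <[e, val x *m v]> = 0 ->
  AdS_orbit v AN (\pi_(AdS v)%qT x) = AdS_proj v AN \/
  AdS_orbit v AN (\pi_(AdS v)%qT x) = AdS_proj v (rtranslate AN k).
Proof.
move=> ex; have fx := f_neq0 ex.
have f2 : 0 < <[f, val x *m v]> ^+ 2 by rewrite exprn_even_gt0.
have := mulf_neq0 (flag_fv fl) fx; rewrite neq_lt => /orP[fx0|fx0]; [right|left].
- have E t : (0 < <[f, val x *m v]> * t) = (<[f, v]> * t < 0).
    rewrite -(nmulr_rlt0 _ fx0) -[RHS](pmulr_rlt0 _ f2); congr (_ < 0); ring.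
  apply: AdS_ext => y; rewrite orbitP proj_minusP ex mul0r ltxx E.
  by split=> [[//|[_ ? ?]]|[? ?]]; [split | right].
- have E t : (0 < <[f, val x *m v]> * t) = (0 < <[f, v]> * t).
    rewrite -(pmulr_rgt0 _ fx0) -[RHS](pmulr_rgt0 _ f2); congr (0 < _); ring.
  apply: AdS_ext => y; rewrite orbitP proj_plusP ex mul0r ltxx E.
  by split=> [[//|[_ ? ?]]|[? ?]]; [split | right].
Qed.

Lemma flag_orbits :
  [set O | AdS_orbits v AN O /\ closed O] =
    [set AdS_proj v AN; AdS_proj v (rtranslate AN k)] /\
  forall O, AdS_orbits v AN O ->
    O <> AdS_proj v AN -> O <> AdS_proj v (rtranslate AN k) -> open O.
Proof.
split.
  apply/seteqP; split=> O.
    move=> [[p _ <-]]; have [x ->] := AdS_piP p => cO.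
    have [ex|ex] := eqVneq <[e, val x *m v]> 0.
      by have [->|->] := orbit_cases ex; [left|right].
    by have [_] := orbit_open_not_closed ex.
  case=> ->; split=> //.
    by rewrite proj_plus_orbit; exists (\pi_(AdS v)%qT one).
  by rewrite proj_minus_orbit; exists (\pi_(AdS v)%qT kG).
move=> O [p _ <-]; have [x ->] := AdS_piP p => n1 n2.
have [ex|ex] := eqVneq <[e, val x *m v]> 0; last by have [] := orbit_open_not_closed ex.
by have [] := orbit_cases ex.
Qed.

End FlagOrbits.

Theorem theorem65 (R : realType) (l : nat) (v : 'cV[R]_l.+1)
    (g h k p q a n nbar : {vspace 'M[R]_l.+1})
    (sigma theta : 'End('M[R]_l.+1)) (K : set 'M[R]_l.+1)
    (J1 J2 Xpp q0 ktheta : 'M[R]_l.+1) (AN ANbar : set 'M[R]_l.+1)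
    (l_ge3 : (3 <= l)%N)
    (v_norm : sqnorm v = 1)
    (g_lie : lie_algebra_of (SO0 R l) g)
    (h_lie : lie_algebra_of (stab v) h)
    (sigma_inv : involutive_automorphism g sigma)
    (sigma_h : eigensubspace g sigma 1 = h)
    (q_def : q = eigensubspace g sigma (-1))
    (theta_cartan : cartan_involution g theta)
    (theta_sigma : forall X, X \in g -> theta (sigma X) = sigma (theta X))
    (k_def : k = eigensubspace g theta 1)
    (p_def : p = eigensubspace g theta (-1))
    (a_max : maximal_abelian p a)
    (a_basis : basis_of a [:: J1; J2])
    (J1_h : J1 \in h)
    (J2_q : J2 \in q)
    (roots : forall al be : R,
       is_restricted_root g J1 J2 al be <-> listed_root l al be)
    (n_def : n = positive_part g J1 J2)
    (nbar_def : nbar = (theta @: n)%VS)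
    (K_max : maximal_compact_subgroup (SO0 R l) K)
    (K_lie : lie_algebra_of K k)
    (Xpp_root : Xpp \in root_space g J1 J2 1 1)
    (Xpp_norm : ad (theta Xpp) Xpp = 4 *: (J1 + J2))
    (q0_def : q0 = 4^-1 *: (Xpp - sigma Xpp + theta Xpp - sigma (theta Xpp)))
    (ktheta_def : ktheta = expm (pi *: q0))
    (AN_def : AN = prod_set (connected_subgroup a) (connected_subgroup n))
    (ANbar_def :
       ANbar = prod_set (connected_subgroup a) (connected_subgroup nbar)) :
  [/\ K ktheta /\ (forall X, X \in g -> theta X = ktheta * X * ktheta^-1),
      [set O | AdS_orbits v AN O /\ closed O] =
        [set AdS_proj v AN; AdS_proj v (rtranslate AN ktheta)],
      [set O | AdS_orbits v ANbar O /\ closed O] =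
        [set AdS_proj v ANbar; AdS_proj v (rtranslate ANbar ktheta)],
      forall O, AdS_orbits v AN O ->
        O <> AdS_proj v AN -> O <> AdS_proj v (rtranslate AN ktheta) -> open O &
      forall O, AdS_orbits v ANbar O ->
        O <> AdS_proj v ANbar -> O <> AdS_proj v (rtranslate ANbar ktheta) -> open O].

Proof.
have gP Y : Y \in g <-> skew Y := mem_lie_skew l_ge3 g_lie Y.
have hP Y : Y \in h <-> skew Y /\ Y *m v = 0 := mem_stab_lie l_ge3 g_lie h_lie Y.
have aP Y : Y \in a -> Y \in g /\ theta Y = - Y.
  case: a_max => ap _ _ /(subvP ap); rewrite p_def => /mem_eigensubspace.
  by rewrite scaleN1r.
have J1a : J1 \in a by apply: (basis_mem a_basis); rewrite !inE eqxx.
have J2a : J2 \in a by apply: (basis_mem a_basis); rewrite !inE eqxx orbT.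
have J2_neq0 : J2 != 0 by apply: (basis_not0 a_basis); rewrite !inE eqxx orbT.
have J12 : ad J1 J2 = 0 by case: a_max => _ + _; exact.
have tJ1 := (aP _ J1a).2; have tJ2 := (aP _ J2a).2.
rewrite q_def in J2_q.
have [[gq0 tq0 kv thetaE] [fln ng] [flnb nbg]] := cartan_structure l_ge3 v_norm gP hP
  sigma_inv sigma_h theta_cartan theta_sigma tJ1 tJ2 J2_neq0 J1_h J2_q J12
  Xpp_root Xpp_norm a_basis.
rewrite /so2_generator -q0_def -ktheta_def in gq0 tq0 kv thetaE flnb.
have Gk : SO0 R l ktheta by rewrite ktheta_def; exact: (g_lie q0).1 gq0 pi.
have ag : (a <= g)%VS by apply/subvP => Y /aP[].
rewrite -n_def in fln ng flnb nbg; rewrite -nbar_def in flnb nbg.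
(* The orbit analysis depends only on the flag, so it applies first to [n] and then to [nbar]. *)
have [closedN openN] := flag_orbits l_ge3 v_norm g_lie ag ng fln Gk kv.
have [closedNb openNb] := flag_orbits l_ge3 v_norm g_lie ag nbg flnb Gk kv.
rewrite AN_def ANbar_def; split=> //; split=> //.
(* [theta] fixes [q0], so [q0] lies in the Lie algebra of [K] and its one-parameter group stays in
   [K]. *)
rewrite ktheta_def; apply: (K_lie q0).1; rewrite k_def.
by apply/mem_eigensubspace; rewrite tq0 scale1r.
Qed.
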